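(* Let $R=R_1\perp\dots\perp R_m\subseteq\mathbb{R}^n$ be the orthogonal sum of irreducible root systems $R_i\in\{A_{n_i},D_{n_i},E_{n_i}\}$, where $n_i$ is the rank of $R_i$ and $n=n_1+\dots+n_m$. Write $H\in\mathcal{S}^n$ in block form $(H_{i,j})_{1\le i,j\le m}$ with $H_{i,i}\in\mathcal{S}^{n_i}$, $H_{i,j}\in\mathbb{R}^{n_i\times n_j}$ and $H_{j,i}=H_{i,j}^{\mathsf T}$, which identifies $\mathcal{S}^n$ with the orthogonal sum of the spaces $\mathcal{S}^{n_i}$, $1\le i\le m$, and $\mathbb{R}^{n_i\times n_j}$, $1\le i<j\le m$. (i) We have $Q_R[H]=Q_{R_1}[H_{1,1}]+\dots+Q_{R_m}[H_{m,m}]$, so the quadratic form depends only on the diagonal entries $H_{i,i}\in\mathcal{S}^{n_i}$, and the eigenvalues of $Q_R$ are the eigenvalues of all the $Q_{R_i}$ and additionally the eigenvalue $0$ with multiplicity $\sum_{1\le i<j\le m}n_in_j$. (ii) If each component root system $R_i$ has the same Coxeter number $h$, we can write $R=(A_{n_a})^{m_a}\perp(D_{n_d})^{m_d}\perp(E_{n_e})^{m_e}$ with $m=m_a+m_d+m_e$ and $n=m_an_a+m_dn_d+m_en_e$. The space $\mathcal{T}_0^n$ of traceless matrices in $\mathcal{S}^n$ then decomposes into eigenspaces of $Q_R$: $$\mathcal{T}_0^n=U_1(A_{n_a})^{m_a}\perp U_2(A_{n_a})^{m_a}\perp U_1(D_{n_d})^{m_d}\perp U_2(D_{n_d})^{m_d}\perp(\mathcal{T}_0^{n_e})^{m_e}\perp(\mathcal{D}\cap\mathcal{T}_0^n),$$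 where the exponents refer to the direct sum of the eigenspaces of $Q_{A_{n_a}},Q_{D_{n_d}}$ and $Q_{E_{n_e}}$. The eigenspace $\mathcal{D}\cap\mathcal{T}_0^n$ belongs to the eigenvalue $4h$ and has dimension $m-1$.
   Context: $\mathcal{S}^k$ is the space of symmetric $k\times k$ matrices with inner product $\langle A,B\rangle=\mathrm{Tr}(AB)$, and $\mathcal{T}_0^k\subseteq\mathcal{S}^k$ its subspace of traceless matrices. For a root system $R$, $Q_R[H]=\sum_{x\in R}H[x]^2$ with $H[x]=x^{\mathsf T}Hx$; eigenvalues of $Q_R$ are those of the Gram matrix of the associated bilinear form $\sum_{x\in R}G[x]H[x]$ in an orthonormal basis of the space of symmetric matrices. The space $\mathcal{D}$ is the $m$-dimensional space of block-diagonal matrices with diagonal blocks $c_1I_{n_1},\dots,c_mI_{n_m}$, $c_i\in\mathbb{R}$. The irreducible root systems are: $A_k=\{\pm(e_i-e_j):1\le i<j\le k+1\}$ regarded in $(1,\dots,1)^\perp\cong\mathbb{R}^k$ ($k\ge1$); $D_k=\{\pm(e_i\pm e_j):1\le i<j\le k\}$ ($k\ge4$); $E_8=D_8\cup\{(\pm e_1\pm\dots\pm e_8)/2 \text{ with an even number of minus signs}\}$, $E_7=E_8\cap(e_7-e_8)^\perp$, $E_6=E_7\cap(e_6-e_7)^\perp$, each regarded in the space it spans. The Coxeter number of a root system $R$ of rank $k$ is $h=|R|/k$. With $M(x,y)=xy^{\mathsf T}+yx^{\mathsf T}$ and $M(x)=xx^{\mathsf T}$: $U_1(A_k)=\mathrm{span}\{M(x,y):x,y\in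 A_k,\ x\cdot y=0\}$; $U_2(A_k)=\mathrm{span}\{P_i:1\le i\le k+1\}$ with $P_i=\sum_{j\ne i}M(e_i-e_j)-2I_k$ (operators on $(1,\dots,1)^\perp\cong\mathbb{R}^k$); $U_1(D_k)=\{M\in\mathcal{S}^k:M_{ii}=0,\ 1\le i\le k\}$; $U_2(D_k)=\{\mathrm{diag}(d_1,\dots,d_k):d_1,\dots,d_k\in\mathbb{R},\ d_1+\dots+d_k=0\}$.
   Formalization: In (ii) the printed decomposition of the traceless matrices omits the off-diagonal blocks R^{n_i×n_j}, i<j, and is false for m≥2 (e.g. A_1⊥A_1); the sum of these blocks is added as a further orthogonal summand, belonging to the eigenvalue 0. *)

(* Defs.v *)
From HB Require Import structures.
From mathcomp Require Import all_boot all_order all_algebra finmap reals.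

Set Implicit Arguments.
Unset Strict Implicit.
Unset Printing Implicit Defensive.

Import Order.TTheory GRing.Theory Num.Theory.

Local Open Scope fset_scope.
Local Open Scope ring_scope.

(* Irreducible types: TypeA k, TypeD k, TypeE k stand for A_k, D_k, E_k. *)
Inductive rtype := TypeA of nat | TypeD of nat | TypeE of nat.

Definition irreducible_type (t : rtype) : bool :=
  match t with
  | TypeA k => (1 <= k)%N
  | TypeD k => (4 <= k)%N
  | TypeE k => k \in [:: 6; 7; 8]%N
  end.

Definition rank (t : rtype) : nat :=
  match t with TypeA k => k | TypeD k => k | TypeE k => k end.

(* The dimension of the space in which the roots are written in the standard
   description: R^(k+1) for A_k, R^k for D_k, R^8 for E_6, E_7 and E_8. *)
Definition ambient (t : rtype) : nat :=
  match t with TypeA k => k.+1 | TypeD k => k | TypeE _ => 8 end.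

Definition is_A (t : rtype) : bool := if t is TypeA _ then true else false.
Definition is_D (t : rtype) : bool := if t is TypeD _ then true else false.
Definition is_E (t : rtype) : bool := if t is TypeE _ then true else false.

Section Forms.
Variable R : realType.

Definition dotv k (x y : 'cV[R]_k) : R := (x^T *m y) 0 0.
Definition Mxy k (x y : 'cV[R]_k) : 'M[R]_k := x *m y^T + y *m x^T.
Definition Mx k (x : 'cV[R]_k) : 'M[R]_k := x *m x^T.

Definition ip k (A B : 'M[R]_k) : R := \tr (A *m B).
Definition symv k : {vspace 'M[R]_k} := fixedSpace (linfun (@trmx R k k)).
Definition traceless k : {vspace 'M[R]_k} :=
  (symv k :&: lker (linfun (@mxtrace R k : 'M[R]_k -> R^o)))%VS.

Lemma symvP k (A : 'M[R]_k) : reflect (A^T = A) (A \in symv k).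
Proof. by apply: (iffP fixedSpaceP); rewrite lfunE. Qed.

Lemma tracelessP k (A : 'M[R]_k) :
  reflect (A^T = A /\ \tr A = 0) (A \in traceless k).
Proof.
rewrite memv_cap memv_ker lfunE /=.
by apply: (iffP andP) => -[/symvP ? /eqP ?].
Qed.

Definition eval k (H : 'M[R]_k) (x : 'cV[R]_k) : R := (x^T *m H *m x) 0 0.
Definition Q k (X : {fset 'cV[R]_k}) (H : 'M[R]_k) : R :=
  \sum_(x <- X) eval H x ^+ 2.
Definition bilin k (X : {fset 'cV[R]_k}) (G H : 'M[R]_k) : R :=
  \sum_(x <- X) eval G x * eval H x.

Definition orthonormal_basis k (b : seq 'M[R]_k) : Prop :=
  basis_of (symv k) b /\
  forall i j : 'I_(size b), ip b`_i b`_j = (i == j)%:R.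

Definition gram k (X : {fset 'cV[R]_k}) (b : seq 'M[R]_k) : 'M[R]_(size b) :=
  \matrix_(i, j) bilin X b`_i b`_j.

Definition multiplicity k (X : {fset 'cV[R]_k}) (b : seq 'M[R]_k) (a : R) : nat :=
  \rank (eigenspace (gram X b) a).

(* V consists of eigenvectors of Q_X (and 0) for the eigenvalue a; see
   [gram_eigenspaceP].  V need not be the whole a-eigenspace: for example
   U_1(D_4) and U_2(D_4) belong to the same eigenvalue. *)
Definition eigen_subspace k (X : {fset 'cV[R]_k}) (a : R)
    (V : {vspace 'M[R]_k}) : Prop :=
  (V <= symv k)%VS /\
  forall G H, G \in symv k -> H \in V -> bilin X G H = a * ip G H.

Lemma eval_linear k (x : 'cV[R]_k) : linear (fun H : 'M[R]_k => eval H x : R^o).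
Proof.
by move=> c A B; rewrite /eval mulmxDr mulmxDl -scalemxAr -scalemxAl !mxE.
Qed.

Lemma gram_eigenspaceP k (X : {fset 'cV[R]_k}) (b : seq 'M[R]_k) (a : R)
    (H : 'M[R]_k) :
  orthonormal_basis b -> H \in symv k ->
  (\row_(j < size b) ip b`_j H <= eigenspace (gram X b) a)%MS <->
  (forall G, G \in symv k -> bilin X G H = a * ip G H).
Proof.
move=> [bb onb] SH.
have bsum (F : {linear 'M[R]_k -> R^o}) G : G \in symv k ->
    F G = \sum_(i < size b) coord (in_tuple b) i G * F b`_i.
  move=> SG; rewrite {1}(coord_basis (X := in_tuple b) bb SG) linear_sum /=.
  by apply: eq_bigr => i _; rewrite linearZ.
have bilinl : forall G', linear (fun G : 'M[R]_k => bilin X G G' : R^o).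
  move=> G' c A B; rewrite /bilin scaler_sumr -big_split /=.
  apply: eq_bigr => x _; rewrite eval_linear mulrDl /=.
  exact: (congr1 (fun z : R => z + _) (esym (mulrA c _ _))).
have ipl : forall G', linear (fun G : 'M[R]_k => ip G G' : R^o).
  by move=> G' c A B; rewrite /ip mulmxDl -scalemxAl linearD linearZ.
pose BL G' := HB.pack_for {linear 'M[R]_k -> R^o}
  (fun G : 'M[R]_k => bilin X G G' : R^o)
  (GRing.isLinear.Build _ _ _ _ _ (bilinl G')).
pose IL G' := HB.pack_for {linear 'M[R]_k -> R^o}
  (fun G : 'M[R]_k => ip G G' : R^o)
  (GRing.isLinear.Build _ _ _ _ _ (ipl G')).
have bilin_sum G G' : G \in symv k ->
    bilin X G G' = \sum_(i < size b) coord (in_tuple b) i G * bilin X b`_i G'.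
  exact: (bsum (BL G') G).
have ip_sum G G' : G \in symv k ->
    ip G G' = \sum_(i < size b) coord (in_tuple b) i G * ip b`_i G'.
  exact: (bsum (IL G') G).
have bilinC A B : bilin X A B = bilin X B A.
  by apply: eq_bigr => x _; rewrite mulrC.
have ipC (A B : 'M[R]_k) : ip A B = ip B A by rewrite /ip mxtrace_mulC.
have ipH (j : 'I_(size b)) : ip b`_j H = coord (in_tuple b) j H.
  rewrite ipC (ip_sum H _ SH) (bigD1 j) //= onb eqxx mulr1 big1 ?addr0 //.
  by move=> i ij; rewrite onb (negPf ij) mulr0.
have E j : ((\row_(j < size b) ip b`_j H) *m gram X b) 0 j = bilin X b`_j H.
  rewrite bilinC (bilin_sum H _ SH) mxE; apply: eq_bigr => i _.
  by rewrite !mxE ipH.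
have inb (j : 'I_(size b)) : b`_j \in symv k.
  by rewrite (basis_mem bb) // mem_nth.
split=> [/eigenspaceP e G SG | e].
  rewrite (bilin_sum G _ SG) (ip_sum G _ SG) mulr_sumr.
  apply: eq_bigr => j _ /=; rewrite mulrCA; congr (_ * _).
  by rewrite -E e !mxE.
by apply/eigenspaceP/rowP => j; rewrite E !mxE e.
Qed.

Definition orthogonal_decomposition k (W : {vspace 'M[R]_k})
    (s : seq {vspace 'M[R]_k}) : Prop :=
  W = (\sum_(V <- s) V)%VS /\
  forall i j, (i < j < size s)%N ->
    forall A B, A \in nth 0%VS s i -> B \in nth 0%VS s j -> ip A B = 0.

End Forms.

Section Roots.
Variable R : realType.

Definition ev {k} (i : 'I_k) : 'cV[R]_k := delta_mx i 0.

Definition pm k (X : {fset 'cV[R]_k}) : {fset 'cV[R]_k} :=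
  X `|` [fset - x | x in X].

Definition lt_pairs k : {set 'I_k * 'I_k} :=
  [set p : 'I_k * 'I_k | (p.1 < p.2)%N].

Definition rootsA k : {fset 'cV[R]_k.+1} :=
  pm [fset ev p.1 - ev p.2 | p in lt_pairs k.+1].

Definition rootsD k : {fset 'cV[R]_k} :=
  pm [fset ev p.1 - ev p.2 | p in lt_pairs k] `|`
  pm [fset ev p.1 + ev p.2 | p in lt_pairs k].

(* s is the set of positions of the minus signs. *)
Definition half_vectors : {fset 'cV[R]_8} :=
  [fset 2^-1 *: \sum_(i < 8) (-1) ^+ (i \in s) *: ev i
    | s : {set 'I_8} in [set s : {set 'I_8} | ~~ odd #|s|]].

(* The coordinates of R^8 are numbered from 0 to 7. *)
Definition rootsE8 : {fset 'cV[R]_8} := rootsD 8 `|` half_vectors.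
Definition rootsE7 : {fset 'cV[R]_8} :=
  [fset x in rootsE8 | dotv x (ev (inord 6) - ev (inord 7)) == 0].
Definition rootsE6 : {fset 'cV[R]_8} :=
  [fset x in rootsE7 | dotv x (ev (inord 5) - ev (inord 6)) == 0].

Definition std_roots (t : rtype) : {fset 'cV[R]_(ambient t)} :=
  match t return {fset 'cV[R]_(ambient t)} with
  | TypeA k => rootsA k
  | TypeD k => rootsD k
  | TypeE k =>
      match k with 6 => rootsE6 | 7 => rootsE7 | _ => rootsE8 end
  end.

(* The rows of E form an orthonormal basis of the space spanned by the standard
   roots; x |-> E *m x identifies that space isometrically with R^(rank t). *)
Definition frame (t : rtype) (E : 'M[R]_(rank t, ambient t)) : Prop :=
  E *m E^T = 1%:M /\
  <<[seq (row i E)^T | i : 'I_(rank t)]>>%VS = <<std_roots t>>%VS.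

Definition root_system (t : rtype) (E : 'M[R]_(rank t, ambient t)) :
    {fset 'cV[R]_(rank t)} :=
  [fset E *m x | x in std_roots t].

Definition coxeter k (X : {fset 'cV[R]_k}) : R := #|` X|%:R / k%:R.

Definition conjmap p q (P : 'M[R]_(p, q)) : 'Hom('M[R]_q, 'M[R]_p) :=
  linfun (mulmxr P^T \o mulmx P).

Lemma conjmapE p q (P : 'M[R]_(p, q)) A : conjmap P A = P *m A *m P^T.
Proof. by rewrite lfunE. Qed.

(* The argument E of U1A, U2A, U1D, U2D is the frame with respect to which
   operators on the span of the roots are written as k x k matrices. *)
Definition orthogonal_pairs k (X : {fset 'cV[R]_k}) : seq ('cV[R]_k * 'cV[R]_k) :=
  [seq p <- [seq (x, y) | x <- X, y <- X] | dotv p.1 p.2 == 0].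

Definition U1A k (E : 'M[R]_(k, k.+1)) : {vspace 'M[R]_k} :=
  <<[seq Mxy p.1 p.2 | p <- orthogonal_pairs (root_system (t := TypeA k) E)]>>%VS.

Definition PA k (E : 'M[R]_(k, k.+1)) (i : 'I_k.+1) : 'M[R]_k :=
  \sum_(j | j != i) Mx (E *m (ev i - ev j)) - 2 *: 1%:M.

Definition U2A k (E : 'M[R]_(k, k.+1)) : {vspace 'M[R]_k} :=
  <<[seq PA E i | i : 'I_k.+1]>>%VS.

Definition diag_of k (M : 'M[R]_k) : 'rV[R]_k := \row_i M i i.
Fact diag_of_is_linear k : linear (@diag_of k).
Proof. by move=> c A B; apply/rowP=> i; rewrite !mxE. Qed.
HB.instance Definition _ k := GRing.isLinear.Build R 'M[R]_k 'rV[R]_k _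
  (@diag_of k) (@diag_of_is_linear k).

Definition coord_sum k (d : 'rV[R]_k) : R^o := \sum_i d 0 i.
Fact coord_sum_is_linear k : linear (@coord_sum k).
Proof.
move=> c A B; rewrite /coord_sum scaler_sumr -big_split /=.
by apply: eq_bigr => i _; rewrite !mxE.
Qed.
HB.instance Definition _ k := GRing.isLinear.Build R 'rV[R]_k R^o _
  (@coord_sum k) (@coord_sum_is_linear k).

Definition std_U1D k : {vspace 'M[R]_k} :=
  (symv R k :&: lker (linfun (@diag_of k)))%VS.
Definition std_U2D k : {vspace 'M[R]_k} :=
  (linfun (@diag_mx R k) @: lker (linfun (@coord_sum k)))%VS.

Lemma std_U1DP k (M : 'M[R]_k) :
  reflect (M^T = M /\ forall i, M i i = 0) (M \in std_U1D k).
Proof.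
rewrite memv_cap memv_ker lfunE /=; apply: (iffP andP) => -[/symvP SM dM].
  by split=> // i; move/eqP/rowP/(_ i): dM; rewrite !mxE.
by split=> //; apply/eqP/rowP=> i; rewrite !mxE.
Qed.

Lemma std_U2DP k (M : 'M[R]_k) :
  reflect (exists2 d : 'rV[R]_k, \sum_i d 0 i = 0 & M = diag_mx d)
          (M \in std_U2D k).
Proof.
apply: (iffP memv_imgP) => -[d d0 ->]; exists d; rewrite ?lfunE //.
  by apply/eqP; move: d0; rewrite memv_ker lfunE.
by rewrite memv_ker lfunE; apply/eqP.
Qed.

Definition U1D k (E : 'M[R]_k) : {vspace 'M[R]_k} := (conjmap E @: std_U1D k)%VS.
Definition U2D k (E : 'M[R]_k) : {vspace 'M[R]_k} := (conjmap E @: std_U2D k)%VS.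

(* The same spaces for a component of arbitrary type, replaced by 0 when the
   component has another type. *)
Definition compU1A (t : rtype) :
    'M[R]_(rank t, ambient t) -> {vspace 'M[R]_(rank t)} :=
  match t with TypeA k => @U1A k | _ => fun=> 0%VS end.
Definition compU2A (t : rtype) :
    'M[R]_(rank t, ambient t) -> {vspace 'M[R]_(rank t)} :=
  match t with TypeA k => @U2A k | _ => fun=> 0%VS end.
Definition compU1D (t : rtype) :
    'M[R]_(rank t, ambient t) -> {vspace 'M[R]_(rank t)} :=
  match t with TypeD k => @U1D k | _ => fun=> 0%VS end.
Definition compU2D (t : rtype) :
    'M[R]_(rank t, ambient t) -> {vspace 'M[R]_(rank t)} :=
  match t with TypeD k => @U2D k | _ => fun=> 0%VS end.
Definition compT0E (t : rtype) : {vspace 'M[R]_(rank t)} :=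
  if is_E t then traceless R (rank t) else 0%VS.

End Roots.

Section OrthogonalSum.
Variables (R : realType) (m : nat) (p : 'I_m -> nat).
Let n := (\sum_i p i)%N.

(* The inclusion of the i-th summand R^(p i) into R^n. *)
Definition incl (i : 'I_m) : 'M[R]_(n, p i) := (submxcol (1%:M : 'M[R]_n) i)^T.

Definition orth_sum (X : forall i, {fset 'cV[R]_(p i)}) : {fset 'cV[R]_n} :=
  \big[fsetU/fset0]_i [fset incl i *m x | x in X i].

(* The spaces U i placed in the i-th diagonal blocks. *)
Definition diag_sum (U : forall i, {vspace 'M[R]_(p i)}) : {vspace 'M[R]_n} :=
  (\sum_i conjmap (incl i) @: U i)%VS.

(* The U i are a-eigenspaces of the forms of the X i, and their direct sum is an
   a-eigenspace of the form of the orthogonal sum. *)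
Definition eigen_power (X : forall i, {fset 'cV[R]_(p i)}) (a : R)
    (U : forall i, {vspace 'M[R]_(p i)}) : Prop :=
  [/\ forall i, eigen_subspace (X i) a (U i),
      directv (\sum_i conjmap (incl i) @: U i) &
      eigen_subspace (orth_sum X) a (diag_sum U)].

Definition offdiag_embed (i j : 'I_m) : 'Hom('M[R]_(p i, p j), 'M[R]_n) :=
  linfun ((mulmxr (incl j)^T \o mulmx (incl i)) \+
          (mulmxr (incl i)^T \o mulmx (incl j) \o trmx)).

Lemma offdiag_embedE i j A :
  offdiag_embed i j A =
  incl i *m A *m (incl j)^T + incl j *m A^T *m (incl i)^T.
Proof. by rewrite lfunE. Qed.

(* The sum of the spaces R^(p i x p j), i < j, inside S^n. *)
Definition offdiag : {vspace 'M[R]_n} :=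
  (\sum_(i < m) \sum_(j < m | (i < j)%N) limg (offdiag_embed i j))%VS.

Definition block_scalar (c : 'rV[R]_m) : 'M[R]_n :=
  \mxdiag_(i < m) ((c 0 i)%:M : 'M[R]_(p i)).
Fact block_scalar_is_linear : linear block_scalar.
Proof.
have Z a (B : forall i, 'M[R]_(p i)) :
    \mxdiag_i (a *: B i) = a *: \mxdiag_i (B i).
  apply/mxblockP => i j.
  have -> (M : 'M[R]_n) : submxblock (a *: M) i j = a *: submxblock M i j.
    by apply/matrixP => s t; rewrite !mxE.
  rewrite !mxblockK; case: eqP => [e|_]; last by rewrite scaler0.
  by subst j; rewrite !conform_mx_id.
move=> a c d; rewrite /block_scalar -Z -mxdiagD; apply/eq_mxdiag => i.
by rewrite !mxE raddfD /= scale_scalar_mx.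
Qed.
HB.instance Definition _ := GRing.isLinear.Build R 'rV[R]_m 'M[R]_n _
  block_scalar block_scalar_is_linear.

Definition Dspace : {vspace 'M[R]_n} := limg (linfun block_scalar).

End OrthogonalSum.

(* Main.v *)
(* The bilinear form of a set of roots X is G, H |-> <G, L_X H> for the operator
   L_X H = sum_x (x^T H x) x x^T, so the eigenspaces of the Gram matrix are the
   kernels of L_X - a on symmetric matrices.  For an orthogonal sum, L only sees
   the diagonal blocks and acts on each of them by the operator of the component;
   this gives (i) and reduces (ii) to one component and to the scalar blocks.  In
   each component sum_x x x^T = 2h I, whose trace identifies h with the Coxeter
   number; hence L I = 4h I, and the scalar blocks have eigenvalue 4h.
   With g, d the diagonals of E^T G E, E^T H E, the component forms are
     A_k : 4 <G, H> + 2 tr G tr H + 2 (k + 1) sum_a g_a d_a,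
     D_k : 8 <G, H> + 4 tr G tr H + (4k - 16) sum_a g_a d_a,
     E_k : 2c <G, H> + c tr G tr H with 2c = 2h/3 + 4,
   the last one because, P being the projection onto the span of the roots,
   sum_x x_i x_j x_k x_l = c (P_ij P_kl + P_ik P_jl + P_il P_jk) for E_k, which is
   a finite check on the explicit list of roots. *)
From HB Require Import structures.
From Stdlib Require Import ZArith.
Require Import Defs.
From mathcomp Require Import all_boot all_order all_algebra finmap reals.
From mathcomp Require Import ring ssrZ.
Import Order.TTheory GRing.Theory Num.Theory.

Set Implicit Arguments.
Unset Strict Implicit.
Unset Printing Implicit Defensive.

Local Open Scope ring_scope.

(** * The operator of a quadratic form *)

(** On traceless H these formulas show the eigenvalues. If d = 0, only the term <G, H> survives and
    the eigenvalue is 4 for U_1(A_k) and 8 for U_1(D_k). On U_2 the diagonal term is again a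
    multiple of <G, H>, which raises these to 2h and 2h - 4. For D_k the space d = 0 is U_1 by
    definition, but U_1(A_k) is given by generators, and the obstacle is to show that they exhaust d
    = 0. This is done by averaging: products of orthogonal roots, weighted by the entries of E^T H
    E, add up to a nonzero multiple of H. A frame is an arbitrary orthonormal basis of the span. The
    computation becomes independent of it because E^T E is forced to be the projection P, given that
    the second moment of the roots is a multiple of P. The off-diagonal blocks have trace zero and
    are killed by L. They are therefore a further summand of the traceless matrices, with eigenvalue
    0, and close the list of spaces as [Off]. *)

Section Operator.
Variable R : realType.

Lemma ipC k (A B : 'M[R]_k) : ip A B = ip B A.
Proof. by rewrite /ip mxtrace_mulC. Qed.

Lemma ip_linear k (A : 'M[R]_k) : linear (ip A : 'M[R]_k -> R^o).
Proof. by move=> c B C; rewrite /ip mulmxDr -scalemxAr linearD linearZ. Qed.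
HB.instance Definition _ k (A : 'M[R]_k) :=
  GRing.isLinear.Build R 'M[R]_k R^o _ (ip A) (ip_linear A).

Lemma ipZr k (A B : 'M[R]_k) c : ip A (c *: B) = c * ip A B.
Proof. exact: linearZ. Qed.

Lemma ip_suml k (I : Type) (r : seq I) (P : pred I) (F : I -> 'M[R]_k) B :
  ip (\sum_(i <- r | P i) F i) B = \sum_(i <- r | P i) ip (F i) B.
Proof. by rewrite ipC linear_sum; apply: eq_bigr => i _; rewrite ipC. Qed.

Lemma ip_conj p q (P : 'M[R]_(p, q)) (A : 'M[R]_p) (B : 'M[R]_q) :
  ip A (conjmap P B) = ip (P^T *m A *m P) B.
Proof.
by rewrite conjmapE /ip mulmxA mxtrace_mulC -!mulmxA mulmxA.
Qed.

Lemma sym_ip_eq0 k (A : 'M[R]_k) : A^T = A -> ip A A = 0 -> A = 0.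
Proof.
move=> SA; rewrite /ip -{1}SA /mxtrace => A0.
have pos i : 0 <= (A^T *m A) i i.
  by rewrite mxE sumr_ge0 // => j _; rewrite mxE -expr2 sqr_ge0.
apply/matrixP => j i; rewrite !mxE; apply/eqP.
have := psumr_eq0P (fun i _ => pos i) A0 (i := i) isT; rewrite mxE => Aii.
have sq l : true -> 0 <= A^T i l * A l i by rewrite mxE -expr2 sqr_ge0.
by have /eqP := psumr_eq0P sq Aii (i := j) isT; rewrite mxE mulf_eq0 orbb.
Qed.

Lemma eval_ip k (H : 'M[R]_k) (x : 'cV[R]_k) : eval H x = ip H (Mx x).
Proof.
rewrite /eval /ip /Mx mulmxA mxtrace_mulC mulmxA.
by rewrite /mxtrace big_ord_recl big_ord0 addr0.
Qed.

Lemma Mx_sym k (x : 'cV[R]_k) : (Mx x)^T = Mx x.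
Proof. by rewrite /Mx trmx_mul trmxK. Qed.

Definition formop k (X : {fset 'cV[R]_k}) (H : 'M[R]_k) : 'M[R]_k :=
  \sum_(x <- X) eval H x *: Mx x.

Lemma formop_linear k X : linear (@formop k X).
Proof.
move=> c A B; rewrite /formop scaler_sumr -big_split /=.
by apply: eq_bigr => x _; rewrite eval_linear scalerDl scalerA.
Qed.
HB.instance Definition _ k X :=
  GRing.isLinear.Build R 'M[R]_k 'M[R]_k _ (@formop k X) (@formop_linear k X).

Lemma formop_sym k X (H : 'M[R]_k) : (formop X H)^T = formop X H.
Proof.
rewrite /formop linear_sum; apply: eq_bigr => x _.
by rewrite linearZ /= Mx_sym.
Qed.

Lemma bilin_formop k X (G H : 'M[R]_k) : bilin X G H = ip G (formop X H).
Proof.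
rewrite /formop linear_sum; apply: eq_bigr => x _.
by rewrite /= ipZr mulrC -eval_ip.
Qed.

(** The full eigenspace as a space of matrices, free of any basis: multiplicities become its
    dimension, and [eigen_subspace] becomes inclusion in it. *)
Definition eigsp k (X : {fset 'cV[R]_k}) (a : R) : {vspace 'M[R]_k} :=
  (symv R k :&: lker (linfun (formop X) - a *: \1)%VF)%VS.

Lemma eigspP k (X : {fset 'cV[R]_k}) (a : R) (H : 'M[R]_k) :
  reflect (H^T = H /\ formop X H = a *: H) (H \in eigsp X a).
Proof.
rewrite memv_cap memv_ker add_lfunE opp_lfunE scale_lfunE id_lfunE lfunE.
rewrite subr_eq0.
by apply: (iffP andP) => -[/symvP ? /eqP ?].
Qed.

(** The defect L H - a H is itself symmetric, so it may serve as the test matrix G, and is then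
    orthogonal to itself. *)
Lemma formop_eigenP k (X : {fset 'cV[R]_k}) (a : R) (H : 'M[R]_k) :
  H^T = H ->
  (forall G, G \in symv R k -> bilin X G H = a * ip G H) ->
  formop X H = a *: H.
Proof.
move=> SH e; apply/eqP; rewrite -subr_eq0; apply/eqP.
have SD : (formop X H - a *: H)^T = formop X H - a *: H.
  by rewrite linearB linearZ /= formop_sym SH.
apply: sym_ip_eq0 => //; rewrite [LHS]linearB /= ipZr.
by rewrite -bilin_formop e ?subrr //; apply/symvP.
Qed.

Lemma eigen_subspaceP k (X : {fset 'cV[R]_k}) a (V : {vspace 'M[R]_k}) :
  eigen_subspace X a V <-> (V <= eigsp X a)%VS.
Proof.
split=> [[/subvP sV e] | /subvP VE].
  apply/subvP => H HV; have /symvP SH := sV _ HV; apply/eigspP; split=> //.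
  by apply: formop_eigenP => // G SG; apply: e.
split; first by apply/subvP => H /VE /eigspP[? _]; apply/symvP.
move=> G H _ /VE /eigspP[_ e].
by rewrite bilin_formop e ipZr.
Qed.

(** Expanding coordinate rows in the orthonormal basis carries the left eigenvectors of the Gram
    matrix bijectively onto [eigsp]. The rows are parametrised through [row_base], so that the
    source is a full space whose dimension is the rank. *)
Lemma multiplicity_dim k (X : {fset 'cV[R]_k}) (b : seq 'M[R]_k) (a : R) :
  orthonormal_basis b -> multiplicity X b a = \dim (eigsp X a).
Proof.
move=> onb; rewrite /multiplicity; have [bb b1] := onb.
set W := eigenspace _ _.
pose f (u : 'rV[R]_(\rank W)) : 'M[R]_k :=
  \sum_(j < size b) (u *m row_base W) 0 j *: b`_j.
have f_lin : linear f.
  move=> c u v; rewrite /f scaler_sumr -big_split /=; apply: eq_bigr => j _.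
  by rewrite mulmxDl -scalemxAl !mxE scalerDl scalerA.
pose fL := HB.pack_for {linear 'rV[R]_(\rank W) -> 'M[R]_k} f
  (GRing.isLinear.Build _ _ _ _ f f_lin).
have ipf u j : ip b`_(j : 'I_(size b)) (f u) = (u *m row_base W) 0 j.
  rewrite linear_sum (bigD1 j) //= ipZr b1 eqxx mulr1 big1 ?addr0 // => i ij.
  by rewrite /= ipZr b1 eq_sym (negPf ij) mulr0.
have rowf u : \row_(j < size b) ip b`_j (f u) = u *m row_base W.
  by apply/rowP => j; rewrite mxE ipf.
have bS (j : 'I_(size b)) : b`_j \in symv R k.
  by rewrite (basis_mem bb) // mem_nth.
have -> : eigsp X a = limg (linfun fL).
  apply/vspaceP => H; apply/eigspP/memv_imgP => [[SH e] | [u _ ->]].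
    have /(gram_eigenspaceP X a onb) [_ h] : H \in symv R k by apply/symvP.
    have {h} : (\row_(j < size b) ip b`_j H <= W)%MS.
      by apply: h => G _; rewrite bilin_formop e linearZ.
    rewrite -(eq_row_base W) => /submxP[u Hu]; exists u; first exact: memvf.
    rewrite lfunE /= /f -Hu.
    rewrite {1}(coord_basis (X := in_tuple b) bb (v := H)); last exact/symvP.
    apply: eq_bigr => j _; rewrite mxE; congr (_ *: _).
    rewrite {2}(coord_basis (X := in_tuple b) bb (v := H)); last exact/symvP.
    rewrite linear_sum (bigD1 j) //= ipZr b1 eqxx mulr1 big1 ?addr0 // => i ij.
    by rewrite /= ipZr b1 eq_sym (negPf ij) mulr0.
  rewrite lfunE /=.
  have Sf : f u \in symv R k by rewrite memv_suml // => j _; rewrite memvZ.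
  split; first exact/symvP.
  apply: formop_eigenP; first exact/symvP.
  apply/(gram_eigenspaceP X a onb) => //; rewrite rowf.
  by apply: submx_trans (submxMl _ _) _; rewrite eq_row_base.
rewrite limg_dim_eq; first by rewrite dimvf /dim /= mul1n.
apply/eqP; rewrite -subv0; apply/subvP => u; rewrite memv_cap memv_ker lfunE /=.
case/andP => _ /eqP fu0; rewrite memv0.
have := rowf u; rewrite fu0.
have -> : \row_(j < size b) ip b`_j (0 : 'M[R]_k) = 0.
  by apply/rowP => j; rewrite !mxE linear0.
move/esym => /(congr1 (mulmxr (pinvmx (row_base W)))) /=.
by rewrite mulmxKp ?row_base_free // mul0mx => ->.
Qed.

End Operator.

(** * Orthogonal sums *)

Lemma big_fset_seq (V : nmodType) (T : choiceType) (X : {fset T}) (s : seq T)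
    (F : T -> V) :
  uniq s -> X =i s -> \sum_(x <- X) F x = \sum_(x <- s) F x.
Proof. by move=> us eXs; apply/perm_big/uniq_perm. Qed.

Lemma big_bigfcup (V : nmodType) (T I : choiceType) (r : seq I)
    (X : I -> {fset T}) (F : T -> V) :
  uniq r ->
  (forall i j x, x \in X i -> x \in X j -> i = j) ->
  \sum_(x <- (\bigcup_(i <- r) X i)%fset) F x =
  \sum_(i <- r) \sum_(x <- X i) F x.
Proof.
move=> + dX; elim: r => [|i r IH] /=; first by rewrite !big_nil.
case/andP => ir ur; rewrite !big_cons -IH // -big_cat /=.
apply: big_fset_seq => [|x]; last by rewrite in_fsetU mem_cat.
rewrite cat_uniq !fset_uniq andbT /=; apply/hasPn => x.
case/bigfcupP => j; rewrite andbT => jr xj; apply: contra ir => xi.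
by rewrite (dX i j x).
Qed.

Section Blocks.
Variables (R : realType) (m : nat) (p : 'I_m -> nat).
Local Notation n := (\sum_i p i)%N.
Local Notation incl := (@incl R m p).
Local Notation offdiag_embed := (@offdiag_embed R m p).

Lemma tr_incl_mulmx k i (A : 'M[R]_(n, k)) : (incl i)^T *m A = submxcol A i.
Proof. by rewrite trmxK submxcol_mul mul1mx. Qed.

Lemma mulmx_incl k j (A : 'M[R]_(k, n)) : A *m incl j = submxrow A j.
Proof.
by apply: trmx_inj; rewrite trmx_mul tr_incl_mulmx tr_submxrow.
Qed.

Lemma submxblock_incl (H : 'M[R]_n) i j :
  (incl i)^T *m H *m incl j = submxblock H i j.
Proof. by rewrite tr_incl_mulmx mulmx_incl -submxblockEv. Qed.

Lemma inclK i : (incl i)^T *m incl i = 1%:M.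
Proof.
by rewrite -[X in X *m _]mulmx1 submxblock_incl -mxdiagZ submxblock_diag.
Qed.

Lemma incl_orth i j : i != j -> (incl i)^T *m incl j = 0.
Proof.
move=> ij; rewrite -[X in X *m _]mulmx1 submxblock_incl -mxdiagZ mxblockK.
by rewrite (negPf ij).
Qed.

Lemma sum_incl : \sum_i incl i *m (incl i)^T = 1%:M.
Proof.
apply/mxblockP => i j; rewrite -!submxblock_incl mulmx_sumr mulmx_suml.
rewrite (@big_only1 _ _ _ _ i) // => [|l li _].
  by rewrite mulmx1 mulmxA inclK mul1mx.
by rewrite mulmxA incl_orth 1?eq_sym // !mul0mx.
Qed.

Lemma incl_decomp (H : 'M[R]_n) :
  H = \sum_i \sum_j incl i *m submxblock H i j *m (incl j)^T.
Proof.
rewrite -[LHS]mul1mx -[LHS]mulmx1 -sum_incl mulmx_suml mulmx_suml.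
apply: eq_bigr => i _; rewrite mulmx_sumr; apply: eq_bigr => j _.
by rewrite -submxblock_incl !mulmxA.
Qed.

Lemma block_sym (H : 'M[R]_n) i j :
  H^T = H -> (submxblock H i j)^T = submxblock H j i.
Proof. by move=> SH; rewrite tr_submxblock SH. Qed.

Lemma submxblock_conj i j k (A : 'M[R]_(p k)) : (i != k) || (j != k) ->
  submxblock (conjmap (incl k) A) i j = 0.
Proof.
rewrite conjmapE -submxblock_incl !mulmxA => /orP[] H.
  by rewrite incl_orth // !mul0mx.
by rewrite -!mulmxA incl_orth 1?eq_sym // !mulmx0.
Qed.

Lemma submxblock_conjK i (A : 'M[R]_(p i)) :
  submxblock (conjmap (incl i) A) i i = A.
Proof.
by rewrite conjmapE -submxblock_incl !mulmxA inclK mul1mx -mulmxA inclK mulmx1.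
Qed.

Lemma lker_conj_incl i : lker (conjmap (incl i)) = 0%VS.
Proof.
apply/eqP/lker0P => A B /(congr1 (fun M => submxblock M i i)).
by rewrite !submxblock_conjK.
Qed.

Lemma conj_sym q r (P : 'M[R]_(q, r)) A : A^T = A -> (conjmap P A)^T = conjmap P A.
Proof. by move=> SA; rewrite !conjmapE !trmx_mul trmxK SA mulmxA. Qed.

Lemma mxtrace_conj_incl i A : \tr (conjmap (incl i) A) = \tr A.
Proof. by rewrite conjmapE mxtrace_mulC mulmxA inclK mul1mx. Qed.

Lemma ip_conj_incl (H : 'M[R]_n) i A :
  ip H (conjmap (incl i) A) = ip (submxblock H i i) A.
Proof. by rewrite ip_conj submxblock_incl. Qed.

Lemma directv_diag (U : forall i, {vspace 'M[R]_(p i)}) :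
  directv (\sum_i conjmap (incl i) @: U i).
Proof.
apply/directv_sum_independent => us Uu u0 i _.
have /memv_imgP[A UA e] := Uu i isT; rewrite e.
move/(congr1 (fun M => submxblock M i i)): u0.
rewrite submxblock_sum submxblock0 (@big_only1 _ _ _ _ i) //.
  by rewrite e submxblock_conjK => ->; rewrite linear0.
move=> j ji _; have /memv_imgP[B UB ->] := Uu j isT.
by rewrite submxblock_conj // eq_sym ji.
Qed.

Lemma diag_sumP (U : forall i, {vspace 'M[R]_(p i)}) (H : 'M[R]_n) :
  reflect ((forall i j, i != j -> submxblock H i j = 0) /\
           (forall i, submxblock H i i \in U i))
          (H \in diag_sum U).
Proof.
apply: (iffP memv_sumP) => [[us Uu ->]|[H0 HU]].
  split=> [i j ij|i]; rewrite submxblock_sum.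
    apply: big1 => k _; have /memv_imgP[A UA ->] := Uu k isT.
    by rewrite submxblock_conj //; move: ij; case: (i =P k) => // ->; rewrite eq_sym.
  rewrite (@big_only1 _ _ _ _ i) //.
    by have /memv_imgP[A UA ->] := Uu i isT; rewrite submxblock_conjK.
  move=> k ki _; have /memv_imgP[A UA ->] := Uu k isT.
  by rewrite submxblock_conj // eq_sym ki.
exists (fun i => conjmap (incl i) (submxblock H i i)) => [i _|].
  by rewrite memv_img ?HU.
rewrite {1}(incl_decomp H); apply: eq_bigr => i _.
rewrite [LHS](@big_only1 _ _ _ _ i) ?conjmapE // => j ji _.
by rewrite H0 1?eq_sym // mulmx0 mul0mx.
Qed.

Lemma submxblock_offdiag_embed i j (A : 'M[R]_(p i, p j)) : i != j ->
  submxblock (offdiag_embed i j A) i j = A.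
Proof.
move=> ij; rewrite offdiag_embedE -submxblock_incl mulmxDr mulmxDl !mulmxA.
rewrite inclK mul1mx -[A *m _ *m _]mulmxA inclK mulmx1.
by rewrite incl_orth // !mul0mx addr0.
Qed.

Lemma submxblock_offdiag_embed0 i j k l (A : 'M[R]_(p i, p j)) :
  (k, l) != (i, j) -> (k, l) != (j, i) ->
  submxblock (offdiag_embed i j A) k l = 0.
Proof.
rewrite !xpair_eqE !negb_and.
move=> a b; rewrite offdiag_embedE -submxblock_incl mulmxDr mulmxDl !mulmxA.
have z i' j' (B : 'M[R]_(p i', p j')) : (k != i') || (l != j') ->
    (incl k)^T *m incl i' *m B *m (incl j')^T *m incl l = 0.
  case/orP => h; first by rewrite incl_orth // !mul0mx.
  by rewrite -mulmxA [(incl j')^T *m _]incl_orth 1?eq_sym // !mulmx0.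
by rewrite !z // addr0.
Qed.

Lemma offdiag_embed_sym i j (A : 'M[R]_(p i, p j)) :
  (offdiag_embed i j A)^T = offdiag_embed i j A.
Proof.
by rewrite offdiag_embedE linearD /= !trmx_mul !trmxK !mulmxA addrC.
Qed.

Lemma offdiag_pairs :
  offdiag R p =
  (\sum_(ij : 'I_m * 'I_m | (ij.1 < ij.2)%N) limg (offdiag_embed ij.1 ij.2))%VS.
Proof. by rewrite /offdiag pair_big_dep. Qed.

(** A symmetric matrix with zero diagonal blocks is recovered from its blocks above the diagonal,
    those below being their transposes. *)
Lemma offdiagP (H : 'M[R]_n) :
  reflect (H^T = H /\ forall i, submxblock H i i = 0) (H \in offdiag R p).
Proof.
rewrite offdiag_pairs; apply: (iffP memv_sumP) => [[us Uu ->]|[SH H0]].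
  split=> [|i].
    rewrite linear_sum /=; apply: eq_bigr => ij lij.
    by have /memv_imgP[A _ ->] := Uu ij lij; rewrite offdiag_embed_sym.
  rewrite submxblock_sum big1 // => -[k l] /= lij.
  have /memv_imgP[A _ ->] := Uu (k, l) lij.
  rewrite submxblock_offdiag_embed0 //; apply/eqP => -[e1 e2];
  by rewrite -e1 -e2 ltnn in lij.
exists (fun ij => offdiag_embed ij.1 ij.2 (submxblock H ij.1 ij.2)).
  by move=> ij _; apply: memv_img; apply: memvf.
rewrite {1}(incl_decomp H) pair_big /=.
rewrite (bigID (fun ij : 'I_m * 'I_m => (ij.1 < ij.2)%N)) /=.
rewrite [X in _ + X](bigID (fun ij : 'I_m * 'I_m => (ij.2 < ij.1)%N)) /=.
rewrite [X in _ + (_ + X)]big1 ?addr0; last first.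
  move=> [i j] /= /andP[]; rewrite -!leqNgt => ji ij.
  have -> : i = j by apply/val_inj/eqP; rewrite eqn_leq ij ji.
  by rewrite H0 mulmx0 mul0mx.
under [RHS]eq_bigr do rewrite offdiag_embedE.
rewrite big_split /=; congr (_ + _).
rewrite (reindex_inj (h := fun ij : 'I_m * 'I_m => (ij.2, ij.1))) /=; last first.
  by move=> [a b] [c d] [-> ->].
apply: eq_big => [[i j]|[i j] _] /=; last by rewrite block_sym.
by case: ltngtP.
Qed.

Lemma dim_offdiag :
  \dim (offdiag R p) = (\sum_(i < m) \sum_(j < m | i < j) p i * p j)%N.
Proof.
rewrite offdiag_pairs pair_big_dep /=.
have dV : directv (\sum_(ij : 'I_m * 'I_m | (ij.1 < ij.2)%N)
    limg (offdiag_embed ij.1 ij.2)).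
  apply/directv_sum_independent => us Uu u0 [i j] /= lij.
  have ij : i != j by apply: contraTneq lij => ->; rewrite ltnn.
  have /memv_imgP[A _ e] := Uu (i, j) lij; rewrite e.
  move/(congr1 (fun M => submxblock M i j)): u0.
  rewrite submxblock_sum submxblock0 (@big_only1 _ _ _ _ (i, j)) //.
    by rewrite e submxblock_offdiag_embed // => ->; rewrite linear0.
  move=> [k l] /= klij lkl.
  have /memv_imgP[B _ ->] := Uu (k, l) lkl.
  rewrite submxblock_offdiag_embed0 // eq_sym //.
  apply: contraTneq lkl => -[-> ->].
  by rewrite -leqNgt ltnW.
rewrite (directvP dV) /=; apply: eq_bigr => -[i j] /= lij.
have ij : i != j by apply: contraTneq lij => ->; rewrite ltnn.
rewrite limg_dim_eq ?dimvf ?dim_matrix //.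
apply/eqP; rewrite -subv0; apply/subvP => A; rewrite memv_cap memv_ker memv0.
case/andP => _ /eqP /(congr1 (fun M => submxblock M i j)).
by rewrite submxblock_offdiag_embed // submxblock0 => ->.
Qed.

Section OrthSum.
Variable X : forall i, {fset 'cV[R]_(p i)}.
Hypothesis X_neq0 : forall i x, x \in X i -> x != 0.

(** The images of distinct summands can meet only in 0. As no [X i] contains 0, the union is
    disjoint and sums over it split. *)
Lemma big_orth_sum (V : nmodType) (F : 'cV[R]_n -> V) :
  \sum_(x <- orth_sum X) F x = \sum_i \sum_(x <- X i) F (incl i *m x).
Proof.
rewrite /orth_sum big_bigfcup ?index_enum_uniq //; last first.
  move=> i j _ /imfsetP[x xX ->] /imfsetP[y yX e].
  apply/eqP; apply: contraTT xX => ij; apply/negP => /X_neq0/negP; apply.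
  by rewrite -[x]mul1mx -(inclK i) -mulmxA e mulmxA incl_orth // mul0mx.
apply: eq_bigr => i _; rewrite big_imfset //=.
move=> x y _ _ /(congr1 (mulmx (incl i)^T)).
by rewrite !mulmxA inclK !mul1mx.
Qed.

Lemma eval_incl (H : 'M[R]_n) i x :
  eval H (incl i *m x) = eval (submxblock H i i) x.
Proof. by rewrite /eval trmx_mul -submxblock_incl !mulmxA. Qed.

Lemma Mx_mul q r (P : 'M[R]_(q, r)) x : Mx (P *m x) = conjmap P (Mx x).
Proof. by rewrite conjmapE /Mx trmx_mul !mulmxA. Qed.

Lemma formop_orth_sum (H : 'M[R]_n) :
  formop (orth_sum X) H =
  \sum_i conjmap (incl i) (formop (X i) (submxblock H i i)).
Proof.
rewrite /formop big_orth_sum; apply: eq_bigr => i _.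
by rewrite linear_sum; apply: eq_bigr => x _; rewrite eval_incl Mx_mul linearZ.
Qed.

Lemma Q_orth_sum (H : 'M[R]_n) :
  Q (orth_sum X) H = \sum_i Q (X i) (submxblock H i i).
Proof.
rewrite /Q big_orth_sum; apply: eq_bigr => i _; apply: eq_bigr => x _.
by rewrite eval_incl.
Qed.

Lemma submxblock_formop (H : 'M[R]_n) i :
  submxblock (formop (orth_sum X) H) i i = formop (X i) (submxblock H i i).
Proof.
rewrite formop_orth_sum submxblock_sum (@big_only1 _ _ _ _ i) ?submxblock_conjK //.
by move=> k ki _; rewrite submxblock_conj // eq_sym ki.
Qed.

Lemma submxblock_formop0 (H : 'M[R]_n) i j : i != j ->
  submxblock (formop (orth_sum X) H) i j = 0.
Proof.
move=> ij; rewrite formop_orth_sum submxblock_sum big1 // => k _.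
by rewrite submxblock_conj //; move: ij; case: (i =P k) => // ->; rewrite eq_sym.
Qed.

Lemma submxblockZ (H : 'M[R]_n) a i j :
  submxblock (a *: H) i j = a *: submxblock H i j.
Proof. by apply/matrixP => s t; rewrite !mxE. Qed.

(** The blocks of L H off the diagonal vanish, so there the eigenvalue equation reads a H_ij = 0.
    Such a block is free if a = 0 and zero otherwise, which is the source of the additional
    eigenvalue 0. *)
Lemma eigsp_orth_sumP a (H : 'M[R]_n) :
  reflect ((forall i, submxblock H i i \in eigsp (X i) a) /\
           (forall i j, i != j -> submxblock H j i = (submxblock H i j)^T /\
              a *: submxblock H i j = 0))
          (H \in eigsp (orth_sum X) a).
Proof.
apply: (iffP (eigspP _ _ _)) => [[SH e]|[H1 H2]].
  split=> [i|i j ij]; last first.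
    by rewrite block_sym // -submxblockZ -e submxblock_formop0.
  by apply/eigspP; rewrite block_sym // -submxblockZ -e submxblock_formop.
split; apply/mxblockP => i j.
  case: (eqVneq i j) => [<-|ij]; rewrite -tr_submxblock.
    by have /eigspP[] := H1 i.
  by have [->] := H2 _ _ ij; rewrite trmxK.
case: (eqVneq i j) => [<-|ij]; rewrite submxblockZ.
  by rewrite submxblock_formop; have /eigspP[] := H1 i.
by rewrite submxblock_formop0 //; have [_ ->] := H2 _ _ ij.
Qed.

Lemma eigsp_orth_sum a :
  eigsp (orth_sum X) a =
  (diag_sum (fun i => eigsp (X i) a) +
   (if a == 0%R then offdiag R p else 0))%VS.
Proof.
apply/vspaceP => H; apply/eigsp_orth_sumP/memv_addP => [[H1 H2]|].
  pose D := \sum_i conjmap (incl i) (submxblock H i i).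
  have Dii i : submxblock D i i = submxblock H i i.
    rewrite submxblock_sum (@big_only1 _ _ _ _ i) ?submxblock_conjK // => k ki _.
    by rewrite submxblock_conj // eq_sym ki.
  have Dij i j : i != j -> submxblock D i j = 0.
    move=> ij; rewrite submxblock_sum big1 // => k _; rewrite submxblock_conj //.
    by move: ij; case: (i =P k) => // ->; rewrite eq_sym.
  exists D; first by apply/diag_sumP; split=> // i; rewrite Dii.
  exists (H - D); last by rewrite addrC subrK.
  case: eqP => [a0|/eqP a0].
    apply/offdiagP; split=> [|i]; last by rewrite submxblockB Dii subrr.
    apply/mxblockP => i j; rewrite -tr_submxblock !submxblockB.
    case: (eqVneq i j) => [<-|ij]; first by rewrite Dii subrr linear0.
    by rewrite (Dij i j ij) (Dij j i) 1?eq_sym // !subr0 (H2 i j ij).1 trmxK.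
  suff -> : H - D = 0 by exact: mem0v.
  apply/mxblockP => i j; rewrite submxblockB submxblock0.
  case: (eqVneq i j) => [<-|ij]; first by rewrite Dii subrr.
  rewrite Dij // subr0; have /eqP := (H2 i j ij).2.
  by rewrite scaler_eq0 (negPf a0) => /eqP.
move=> [D /diag_sumP[D0 D1]] [O OO ->].
have [SO [O0 aO]] : O^T = O /\ (forall i, submxblock O i i = 0) /\
    (forall i j, a *: submxblock O i j = 0).
  move: OO; case: eqP => [-> /offdiagP[? ?]|_].
    by do !split=> //; move=> i j; rewrite scale0r.
  rewrite memv0 => /eqP ->; split; rewrite ?linear0 //.
  by split=> *; rewrite submxblock0 ?scaler0.
split=> [i|i j ij]; first by rewrite submxblockD O0 addr0.
by rewrite !submxblockD (D0 i j ij) (D0 j i) 1?eq_sym // !add0r aO block_sym.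
Qed.

Lemma dim_eigsp_orth_sum a :
  \dim (eigsp (orth_sum X) a) =
  (\sum_i \dim (eigsp (X i) a) +
   (if a == 0%R then \sum_(i < m) \sum_(j < m | i < j) p i * p j else 0))%N.
Proof.
rewrite eigsp_orth_sum dimv_disjoint_sum; last first.
  apply/eqP; rewrite -subv0; apply/subvP => H; rewrite memv_cap memv0.
  case/andP => /diag_sumP[D0 D1] HO; have {HO} H0 i : submxblock H i i = 0.
    move: HO; case: eqP => [_ /offdiagP[_]|_]; first exact.
    by rewrite memv0 => /eqP ->; rewrite submxblock0.
  apply/eqP/mxblockP => i j; rewrite submxblock0.
  by case: (eqVneq i j) => [<-|/D0].
congr (_ + _)%N; last by case: eqP => _; rewrite ?dim_offdiag ?dimv0.
rewrite (directvP (directv_diag _)) /=; apply: eq_bigr => i _.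
by rewrite limg_dim_eq // lker_conj_incl capv0.
Qed.

Lemma eigen_powerP a (U : forall i, {vspace 'M[R]_(p i)}) :
  (forall i, U i <= eigsp (X i) a)%VS -> eigen_power X a U.
Proof.
move=> UE; split=> [i||]; first exact/eigen_subspaceP; first exact: directv_diag.
apply/eigen_subspaceP/subvP => H /diag_sumP[H0 H1].
apply/eigsp_orth_sumP; split=> [i|i j ij]; first exact: (subvP (UE i) _ (H1 i)).
by rewrite (H0 i j ij) (H0 j i) 1?eq_sym // trmx0 scaler0.
Qed.

End OrthSum.
End Blocks.

(** * Frames and enumeration of roots *)

Section Frames.
Variables (R : realType) (N k : nat) (E : 'M[R]_(k, N)) (X : {fset 'cV[R]_N}).
Hypothesis EEt : E *m E^T = 1%:M.
Hypothesis E_span : <<[seq (row i E)^T | i : 'I_k]>>%VS = <<X>>%VS.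

Lemma mulmx_ker_span r (B : 'M[R]_(r, N)) (s : seq 'cV[R]_N) :
  (forall x, x \in s -> B *m x = 0) -> forall x, x \in <<s>>%VS -> B *m x = 0.
Proof.
move=> Bs x xs; have /subvP/(_ x xs) : (<<s>> <= lker (linfun (mulmx B)))%VS.
  by apply/span_subvP => y ys; rewrite memv_ker lfunE /= Bs.
by rewrite memv_ker lfunE => /eqP.
Qed.

Lemma frame_kill r (B : 'M[R]_(r, N)) :
  (forall x, x \in X -> B *m x = 0) -> B *m E^T = 0.
Proof.
move=> BX; apply: trmx_inj; rewrite trmx_mul trmxK trmx0.
apply/row_matrixP => i; rewrite row_mul row0; apply: trmx_inj.
rewrite trmx_mul trmxK trmx0; apply: (mulmx_ker_span BX); rewrite -E_span.
by apply: memv_span; apply: image_f.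
Qed.

(** On the rows of E the map E^T E is the identity because E E^T = 1, and these rows span the same
    space as X. *)
Lemma frame_rootK x : x \in X -> E^T *m (E *m x) = x.
Proof.
move=> xX; apply/eqP; rewrite mulmxA -subr_eq0 -{2}[x]mul1mx -mulmxBl; apply/eqP.
have : x \in <<[seq (row i E)^T | i : 'I_k]>>%VS by rewrite E_span memv_span.
apply: mulmx_ker_span => y /imageP[i _ ->].
rewrite mulmxBl mul1mx -mulmxA; apply/eqP; rewrite subr_eq0; apply/eqP.
have -> : E *m (row i E)^T = (row i 1%:M)^T.
  by apply: trmx_inj; rewrite trmx_mul !trmxK -row_mul EEt.
by rewrite -trmx_mul -row_mul mul1mx.
Qed.

Lemma frame_inj : {in X &, injective (mulmx E)}.
Proof. by move=> x y xX yX /= e; rewrite -(frame_rootK xX) e frame_rootK. Qed.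

(** E^T E fixes the roots, so the moment identity gives E^T E P = P; and P fixes the roots, whose
    span contains the rows of E, so E P = E. *)
Lemma frame_proj (P : 'M[R]_N) c : P^T = P -> c != 0 ->
  (forall x, x \in X -> P *m x = x) -> \sum_(x <- X) Mx x = c *: P ->
  E^T *m E = P.
Proof.
move=> SP c0 PX sX.
have QP : E^T *m E *m P = P.
  apply: (scalerI c0); rewrite scalemxAr -sX mulmx_sumr big_seq [RHS]big_seq.
  by apply: eq_bigr => x xX; rewrite /Mx mulmxA -[_ *m x]mulmxA frame_rootK.
have PE : P *m E^T = E^T.
  apply/eqP; rewrite -subr_eq0 -{2}[E^T]mul1mx -mulmxBl; apply/eqP.
  by apply: frame_kill => x xX; rewrite mulmxBl mul1mx PX ?subrr.
have EP : E *m P = E by apply: trmx_inj; rewrite trmx_mul SP.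
by rewrite -QP -mulmxA EP.
Qed.

Lemma big_frame (V : nmodType) (F : 'cV[R]_k -> V) :
  \sum_(y <- [fset E *m x | x in X]%fset) F y = \sum_(x <- X) F (E *m x).
Proof. by rewrite big_imfset //=; apply: frame_inj. Qed.

Lemma eval_mul (G : 'M[R]_k) x : eval G (E *m x) = eval (E^T *m G *m E) x.
Proof. by rewrite /eval trmx_mul !mulmxA. Qed.

Lemma bilin_frame (G H : 'M[R]_k) :
  bilin [fset E *m x | x in X]%fset G H =
  bilin X (E^T *m G *m E) (E^T *m H *m E).
Proof. by rewrite /bilin big_frame; apply: eq_bigr => x _; rewrite !eval_mul. Qed.

Lemma sum_Mx_frame c P : P^T = P -> c != 0 ->
  (forall x, x \in X -> P *m x = x) -> \sum_(x <- X) Mx x = c *: P ->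
  \sum_(y <- [fset E *m x | x in X]%fset) Mx y = c *: 1%:M.
Proof.
move=> SP c0 PX sX; rewrite big_frame.
under eq_bigr do rewrite Mx_mul.
rewrite -linear_sum sX linearZ /= conjmapE -(frame_proj SP c0 PX sX).
by rewrite !mulmxA EEt mul1mx EEt.
Qed.

Lemma dotv_frame : (forall x, x \in X -> dotv x x = 2) ->
  forall y, y \in [fset E *m x | x in X]%fset -> dotv y y = 2.
Proof.
move=> X2 y /imfsetP[x /= xX ->]; rewrite /dotv trmx_mul -mulmxA.
by rewrite frame_rootK // -(X2 x xX).
Qed.

End Frames.

Lemma mxtrace_Mx (R : realType) k (x : 'cV[R]_k) : \tr (Mx x) = dotv x x.
Proof. by rewrite /Mx mxtrace_mulC /mxtrace big_ord_recl big_ord0 addr0. Qed.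

Lemma dotv2_neq0 (R : realType) k (x : 'cV[R]_k) : dotv x x = 2 -> x != 0.
Proof.
move=> x2; apply: contra_eq_neq x2 => ->.
by rewrite /dotv mulmx0 mxE eq_sym pnatr_eq0.
Qed.

Lemma coxeter_sum_Mx (R : realType) k (Y : {fset 'cV[R]_k}) (h : R) : (0 < k)%N ->
  (forall y, y \in Y -> dotv y y = 2) -> \sum_(y <- Y) Mx y = (2 * h) *: 1%:M ->
  coxeter Y = h.
Proof.
move=> k0 Y2 /(congr1 mxtrace); rewrite linear_sum linearZ /= mxtrace1.
rewrite big_seq; under eq_bigr => y yY do rewrite mxtrace_Mx Y2 //.
have two0 : 2 != 0 :> R by rewrite pnatr_eq0.
rewrite -big_seq big_const_seq count_predT iter_addr_0 -(mulr_natr _ #|` Y|) -mulrA.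
move/(mulfI two0) => e; rewrite /coxeter e mulfK //.
by rewrite pnatr_eq0 -lt0n.
Qed.

Section SignedPairs.
Variable R : realType.

Definition sidx k : finType := (('I_k * 'I_k) * (bool * bool))%type.

(** One parametrisation for A_k and D_k: the bit c chooses between e_i - e_j (true) and e_i + e_j
    (false), and the bit s is the overall sign. *)
Definition signed_pair k (i : ('I_k * 'I_k) * (bool * bool)) : 'cV[R]_k :=
  (-1) ^+ i.2.2 *: (ev R i.1.1 + (-1) ^+ i.2.1 *: ev R i.1.2).

Lemma signed_pairE k (i : ('I_k * 'I_k) * (bool * bool)) l :
  signed_pair i l 0 =
  (-1) ^+ i.2.2 * ((l == i.1.1)%:R + (-1) ^+ i.2.1 * (l == i.1.2)%:R).
Proof. by rewrite !mxE eqxx !andbT. Qed.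

(** If the first positions of two equal vectors differed, each would be the second position of the
    other, against the two orderings. With equal first positions, the coordinate there gives s, and
    the coordinate at b gives the rest. *)
Lemma signed_pair_inj k :
  {in [pred i : ('I_k * 'I_k) * (bool * bool) | (i.1.1 < i.1.2)%N] &,
    injective (@signed_pair k)}.
Proof.
move=> [[a b] [c s]] [[a' b'] [c' s']]; rewrite !inE /= => ab ab' e.
have coord l : (-1) ^+ s * ((l == a)%:R + (-1) ^+ c * (l == b)%:R) =
    (-1) ^+ s' * ((l == a')%:R + (-1) ^+ c' * (l == b')%:R) :> R.
  by have := congr1 (fun v : 'cV_k => v l 0) e; rewrite !signed_pairE.
have ltn_neq (i j : 'I_k) : (i < j)%N -> (i == j = false) * (j == i = false).
  by move=> ij; rewrite -!val_eqE /= ltn_eqF // gtn_eqF.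
have {e} aa' : a = a'.
  move: (coord a) (coord a'); rewrite !eqxx (ltn_neq _ _ ab) (ltn_neq _ _ ab').
  rewrite !mulr0 !addr0 (eq_sym a' a).
  case: (eqVneq a a') => // _; rewrite !add0r.
  case: (eqVneq a b') => [ab'e|_]; last by move/eqP; rewrite !mulr0 mulr1 signr_eq0.
  case: (eqVneq a' b) => [a'b|_]; last first.
    by move=> _ /eqP; rewrite !mulr0 mulr1 eq_sym signr_eq0.
  by move: ab ab'; rewrite -ab'e -a'b => /ltn_trans H /H; rewrite ltnn.
subst a'; move: (coord a); rewrite eqxx (ltn_neq _ _ ab) (ltn_neq _ _ ab').
rewrite !mulr0 !addr0 !mulr1 => /signr_inj ss; subst s'.
move: (coord b); rewrite eqxx (ltn_neq _ _ ab) => /(mulfI (negbT (signr_eq0 R s))).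
rewrite !add0r mulr1.
case: (eqVneq b b') => [->|_]; first by rewrite mulr1 => /signr_inj ->.
by move/eqP; rewrite mulr0 signr_eq0.
Qed.

Lemma mem_pm_signed k (c : bool) (v : 'I_k * 'I_k -> 'cV[R]_k) (x : 'cV[R]_k) :
  (forall p, v p = ev R p.1 + (-1) ^+ c *: ev R p.2) ->
  reflect (exists i : sidx k, [/\ (i.1.1 < i.1.2)%N, i.2.1 = c & x = signed_pair i])
          (x \in pm [fset v p | p in lt_pairs k]%fset).
Proof.
move=> vE; rewrite /pm in_fsetU; apply: (iffP orP) => [[]|].
- case/imfsetP => p /=; rewrite inE => lp ->; exists (p, (c, false)).
  by rewrite /signed_pair scale1r vE.
- case/imfsetP => y /= /imfsetP[p /=]; rewrite inE => lp -> ->.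
  by exists (p, (c, true)); rewrite /signed_pair scaleN1r vE.
case=> -[p [c' s]] /= [lp -> ->]; have vin : v p \in [fset v p | p in lt_pairs k]%fset.
  by rewrite in_imfset // inE.
case: s; [right|left]; rewrite /signed_pair /= -vE ?scale1r //.
by apply/imfsetP; exists (v p); rewrite ?scaleN1r.
Qed.

Let minusE k (p : 'I_k * 'I_k) :
  ev R p.1 - ev R p.2 = ev R p.1 + (-1) ^+ true *: ev R p.2.
Proof. by rewrite scaleN1r. Qed.

Let plusE k (p : 'I_k * 'I_k) :
  ev R p.1 + ev R p.2 = ev R p.1 + (-1) ^+ false *: ev R p.2.
Proof. by rewrite scale1r. Qed.

Lemma rootsAP k x :
  reflect (exists i : sidx k.+1, [/\ (i.1.1 < i.1.2)%N, i.2.1 = true & x = signed_pair i])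
          (x \in rootsA R k).
Proof. exact/mem_pm_signed/minusE. Qed.

Lemma rootsDP k x :
  reflect (exists2 i : sidx k, (i.1.1 < i.1.2)%N & x = signed_pair i) (x \in rootsD R k).
Proof.
rewrite /rootsD in_fsetU; apply: (iffP orP) => [[]|].
- by case/(mem_pm_signed x (@minusE k)) => i [? _ ?]; exists i.
- by case/(mem_pm_signed x (@plusE k)) => i [? _ ?]; exists i.
case=> -[p [[] s]] lp ->; [left|right].
  by apply/(mem_pm_signed _ (@minusE k)); exists (p, (true, s)).
by apply/(mem_pm_signed _ (@plusE k)); exists (p, (false, s)).
Qed.

Lemma big_signed (V : nmodType) k (X : {fset 'cV[R]_k}) (P : pred bool)
    (F : 'cV[R]_k -> V) :
  (forall x, reflect (exists i : sidx k, [/\ (i.1.1 < i.1.2)%N, P i.2.1 & x = signed_pair i])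
     (x \in X)) ->
  \sum_(x <- X) F x =
  \sum_(p : 'I_k * 'I_k | (p.1 < p.2)%N) \sum_(c | P c) \sum_s
     F (signed_pair (p, (c, s))).
Proof.
move=> XP; pose A := [pred i : ('I_k * 'I_k) * (bool * bool) |
  (i.1.1 < i.1.2)%N && P i.2.1].
rewrite (@big_fset_seq _ _ _ [seq signed_pair i | i <- enum A]); first last.
- move=> x; apply/XP/mapP => -[i].
    by case=> lt Pi ->; exists i => //; rewrite mem_enum inE lt.
  by rewrite mem_enum inE => /andP[? ?] ->; exists i.
- rewrite map_inj_in_uniq ?enum_uniq // => i j; rewrite !mem_enum !inE.
  by case/andP => li _ /andP[lj _]; apply: signed_pair_inj.
rewrite big_map big_enum /=.
under [RHS]eq_bigr do rewrite pair_big_dep /=.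
by rewrite pair_big_dep /=; apply: eq_big => [[[a b] [c s]]|[[a b] [c s]] _] //=; rewrite andbT.
Qed.

Lemma sum_ltn_sym (V : zmodType) k (f : 'I_k -> 'I_k -> V) :
  (forall i j, f i j = f j i) -> (forall i, f i i = 0) ->
  \sum_i \sum_j f i j = \sum_(p : 'I_k * 'I_k | (p.1 < p.2)%N) f p.1 p.2 *+ 2.
Proof.
move=> fC f0; rewrite pair_big /=.
rewrite (bigID (fun p : 'I_k * 'I_k => (p.1 < p.2)%N)) /=.
under [RHS]eq_bigr do rewrite mulr2n.
rewrite [RHS]big_split /=; congr (_ + _).
rewrite (bigID (fun p : 'I_k * 'I_k => (p.2 < p.1)%N)) /=.
rewrite [X in _ + X]big1 => [|[i j] /=]; last first.
  rewrite -!leqNgt => /andP[a b].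
  by have -> : i = j by apply/val_inj/eqP; rewrite eqn_leq a b.
rewrite addr0 (reindex_inj (h := fun p : 'I_k * 'I_k => (p.2, p.1))) /=; last first.
  by move=> [? ?] [? ?] [-> ->].
by apply: eq_big => [[i j]|[i j] _] //=; case: ltngtP.
Qed.

(** The two signs of a root account for the pairs (i, j) and (j, i), and the diagonal adds only F 0
    = 0. The sum over all ordered pairs is unrestricted and factors easily. *)
Lemma big_rootsA (V : zmodType) k (F : 'cV[R]_k.+1 -> V) :
  F 0 = 0 -> (forall x, F (- x) = F x) ->
  \sum_(x <- rootsA R k) F x = \sum_i \sum_j F (ev R i - ev R j).
Proof.
move=> F0 FN; rewrite (@big_signed _ _ _ id); last exact: rootsAP.
rewrite sum_ltn_sym => [|i j|i]; last 2 first.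
- by rewrite -FN opprB.
- by rewrite subrr.
apply: eq_bigr => p _; rewrite big_mkcond !big_bool /= addr0.
by rewrite /signed_pair /= expr0 expr1 !scale1r !scaleN1r FN.
Qed.

End SignedPairs.

(** * Moments of the standard roots *)

Section Moments.
Variable R : realType.
Local Notation ev := (ev R).

(** Unlike in type A the diagonal has to be cut out, because e_i + e_i is not zero. *)
Lemma big_rootsD (V : zmodType) k (F : 'cV[R]_k -> V) :
  (forall x, F (- x) = F x) ->
  \sum_(x <- rootsD R k) F x =
  \sum_i \sum_j (F (ev i - ev j) + F (ev i + ev j)) *+ (i != j).
Proof.
move=> FN; rewrite (@big_signed _ _ _ _ predT); last first.
  move=> x; apply: (iffP (rootsDP x)); first by case=> i li ->; exists i.
  by case=> i [li _ ->]; exists i.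
rewrite sum_ltn_sym => [|i j|i]; last by rewrite eqxx.
  apply: eq_bigr => p lp; have -> : p.1 != p.2 by rewrite -val_eqE /= ltn_eqF.
  rewrite !big_bool /signed_pair /= expr0 expr1 !scale1r !scaleN1r !FN.
  by rewrite mulr1n -!mulr2n mulrnDl.
by rewrite eq_sym -(FN (ev i - ev j)) opprB (addrC (ev i)).
Qed.

Lemma quad_ev k (G : 'M[R]_k) i j : ((ev i)^T *m G *m ev j) 0 0 = G i j.
Proof. by rewrite /ev trmx_delta -rowE -colE !mxE. Qed.

Lemma addmxE p q (A B : 'M[R]_(p, q)) i j : (A + B) i j = A i j + B i j.
Proof. exact: mxE. Qed.

Lemma scalemxE p q c (A : 'M[R]_(p, q)) i j : (c *: A) i j = c * A i j.
Proof. exact: mxE. Qed.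

Lemma oppmxE p q (A : 'M[R]_(p, q)) i j : (- A) i j = - A i j.
Proof. exact: mxE. Qed.

Lemma eval_evD k (G : 'M[R]_k) i j : G^T = G ->
  eval G (ev i + ev j) = G i i + G j j + 2 * G i j.
Proof.
move=> SG; have Gji : G j i = G i j by rewrite -{1}SG mxE.
rewrite /eval [(_ + _)^T]linearD /= !mulmxDl !mulmxDr !addmxE !quad_ev Gji.
by ring.
Qed.

Lemma eval_evB k (G : 'M[R]_k) i j : G^T = G ->
  eval G (ev i - ev j) = G i i + G j j - 2 * G i j.
Proof.
move=> SG; have Gji : G j i = G i j by rewrite -{1}SG mxE.
rewrite /eval [(_ - _)^T]linearB /= !mulmxBl !mulmxBr.
by rewrite !(addmxE, oppmxE) !quad_ev Gji; ring.
Qed.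

Lemma evalN k (G : 'M[R]_k) x : eval G (- x) = eval G x.
Proof. by rewrite /eval [(- _)^T]linearN /= !mulNmx mulmxN opprK. Qed.

Lemma eval0 k (G : 'M[R]_k) : eval G 0 = 0.
Proof. by rewrite /eval mulmx0 mxE. Qed.

Lemma MxN k (x : 'cV[R]_k) : Mx (- x) = Mx x.
Proof. by rewrite /Mx [(- _)^T]linearN /= mulNmx mulmxN opprK. Qed.

Lemma ip_sum k (G H : 'M[R]_k) : H^T = H ->
  ip G H = \sum_i \sum_j G i j * H i j.
Proof.
move=> SH; rewrite /ip /mxtrace; apply: eq_bigr => i _; rewrite mxE.
by apply: eq_bigr => j _; rewrite -{1}SH mxE.
Qed.

Section DoubleSums.
Variables (k : nat).
Implicit Types (a b : 'I_k -> R) (B : 'M[R]_k).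

Lemma dsum_l a : \sum_(i < k) \sum_(j < k) a i = k%:R * \sum_i a i.
Proof.
by rewrite mulr_sumr; apply: eq_bigr => i _; rewrite sumr_const card_ord mulr_natl.
Qed.

Lemma dsum_r a : \sum_(i < k) \sum_(j < k) a j = k%:R * \sum_i a i.
Proof. by rewrite exchange_big dsum_l. Qed.

Lemma dsum_mul a b :
  \sum_(i < k) \sum_(j < k) a i * b j = (\sum_i a i) * \sum_j b j.
Proof. by rewrite mulr_suml; apply: eq_bigr => i _; rewrite mulr_sumr. Qed.

Lemma dsumZ c (f : 'I_k -> 'I_k -> R) :
  \sum_i \sum_j c * f i j = c * \sum_i \sum_j f i j.
Proof. by rewrite mulr_sumr; apply: eq_bigr => i _; rewrite mulr_sumr. Qed.

Lemma dsumD (f g : 'I_k -> 'I_k -> R) :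
  \sum_i \sum_j (f i j + g i j) =
  \sum_i \sum_j f i j + \sum_i \sum_j g i j.
Proof. by rewrite -big_split; apply: eq_bigr => i _; rewrite -big_split. Qed.

Lemma dsum_row a B : (forall i, \sum_j B i j = 0) ->
  \sum_(i < k) \sum_(j < k) a i * B i j = 0.
Proof. by move=> B0; apply: big1 => i _; rewrite -mulr_sumr B0 mulr0. Qed.

Lemma dsum_col a B : B^T = B -> (forall i, \sum_j B i j = 0) ->
  \sum_(i < k) \sum_(j < k) a j * B i j = 0.
Proof.
move=> SB B0; rewrite exchange_big -[RHS](dsum_row a B0) /=.
by apply: eq_bigr => i _; apply: eq_bigr => j _; rewrite -{1}SB mxE.
Qed.

End DoubleSums.

(** In the expanded product the terms that mix a diagonal entry of one matrix with an entry (i, j)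
    of the other cancel, since all rows sum to zero. *)
Lemma bilin_rootsA k (G H : 'M[R]_k.+1) : G^T = G -> H^T = H ->
  (forall i, \sum_j G i j = 0) -> (forall i, \sum_j H i j = 0) ->
  bilin (rootsA R k) G H =
  4 * ip G H + 2 * \tr G * \tr H + 2 * k.+1%:R * \sum_i G i i * H i i.
Proof.
move=> SG SH G0 H0; rewrite /bilin big_rootsA; first last.
- by move=> x; rewrite !evalN.
- by rewrite !eval0 mul0r.
under eq_bigr => i _ do under eq_bigr => j _ do rewrite !eval_evB //.
have G0' j : \sum_i G i j = 0.
  by rewrite -[RHS](G0 j); apply: eq_bigr => i _; rewrite -{1}SG mxE.
have H0' j : \sum_i H i j = 0.
  by rewrite -[RHS](H0 j); apply: eq_bigr => i _; rewrite -{1}SH mxE.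
transitivity (\sum_i \sum_j (G i i * H i i + G j j * H j j
   + G i i * H j j + H i i * G j j + 4 * (G i j * H i j)
   + (- 2 * G i i) * H i j + (- 2 * H i i) * G i j
   + (- 2 * G j j) * H i j + (- 2 * H j j) * G i j)).
  by apply: eq_bigr => i _; apply: eq_bigr => j _; ring.
rewrite !dsumD dsum_l dsum_r !dsum_mul !dsum_row // !dsum_col // ip_sum //.
by rewrite dsumZ /mxtrace; ring.
Qed.

Lemma bilin_rootsD k (G H : 'M[R]_k) : G^T = G -> H^T = H ->
  bilin (rootsD R k) G H =
  8 * ip G H + 4 * \tr G * \tr H + (4 * k%:R - 16) * \sum_i G i i * H i i.
Proof.
move=> SG SH; rewrite /bilin big_rootsD; last by move=> x; rewrite !evalN.
under eq_bigr => i _ do under eq_bigr => j _ do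
  rewrite !eval_evD // !eval_evB // -(mulr_natr _ (_ != _)).
(* The polynomial summand is extended to i = j, where its value is 16 G_ii H_ii, and this is
   subtracted again. The mixed terms have cancelled between e_i - e_j and e_i + e_j. *)
transitivity (\sum_i \sum_j (2 * (G i i * H i i) + 2 * (G j j * H j j)
   + (2 * G i i) * H j j + (2 * H i i) * G j j + 8 * (G i j * H i j)) -
   \sum_i \sum_j (if j == i then 16 * (G i i * H i i) else 0)).
  rewrite -sumrB; apply: eq_bigr => i _; rewrite -sumrB; apply: eq_bigr => j _.
  rewrite eq_sym; case: eqVneq => [->|_] /=; rewrite ?mulr0n ?mulr1n; ring.
under [X in _ - X]eq_bigr do rewrite -big_mkcond big_pred1_eq.
rewrite !dsumD dsum_l dsum_r !dsum_mul ip_sum //.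
by rewrite dsumZ -!mulr_sumr /mxtrace; ring.
Qed.

Lemma Mx_evE k (i j a b : 'I_k) (c : R) :
  Mx (ev i + c *: ev j) a b =
  ((a == i)%:R + c * (a == j)%:R) * ((b == i)%:R + c * (b == j)%:R).
Proof. by rewrite /Mx mxE big_ord_recl big_ord0 !mxE eqxx !andbT addr0. Qed.

Lemma sum_deltaE k (a : 'I_k) (f : 'I_k -> R) :
  \sum_i (a == i)%:R * f i = f a.
Proof.
rewrite (@big_only1 _ _ _ _ a) ?eqxx ?mul1r // => i ia _.
by rewrite eq_sym (negPf ia) mul0r.
Qed.

Lemma sum_Mx_rootsA k :
  \sum_(x <- rootsA R k) Mx x =
  (2 * k.+1%:R) *: (1%:M - k.+1%:R^-1 *: const_mx 1).
Proof.
rewrite big_rootsA; first last.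
- exact: MxN.
- by rewrite /Mx mul0mx.
apply/matrixP => a b; rewrite summxE; under eq_bigr do rewrite summxE.
transitivity (\sum_i \sum_j ((a == i)%:R * (b == i)%:R + (a == j)%:R * (b == j)%:R
   + - (a == i)%:R * (b == j)%:R + - (b == i)%:R * (a == j)%:R : R)).
  apply: eq_bigr => i _; apply: eq_bigr => j _.
  by rewrite -[- ev j]scaleN1r Mx_evE; ring.
rewrite !dsumD dsum_l dsum_r !dsum_mul !sum_deltaE.
have d1 (c : 'I_k.+1) : \sum_i (c == i)%:R = 1 :> R.
  by rewrite -[RHS](sum_deltaE c (fun=> 1)); apply: eq_bigr => i _; rewrite mulr1.
rewrite !sumrN !d1 !mxE mulr1 eq_sym.
have: k.+1%:R != 0 :> R by rewrite pnatr_eq0.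
by move: k.+1%:R => N N0; field.
Qed.

Lemma sum_Mx_rootsD k : (0 < k)%N ->
  \sum_(x <- rootsD R k) Mx x = (2 * (2 * (k.-1)%:R)) *: 1%:M.
Proof.
case: k => // k _; rewrite big_rootsD; last exact: MxN.
apply/matrixP => a b; rewrite summxE; under eq_bigr do rewrite summxE.
transitivity (\sum_i \sum_j (2 * ((a == i)%:R * (b == i)%:R) + 2 * ((a == j)%:R * (b == j)%:R)) -
  \sum_i \sum_j (if j == i then 4 * ((a == i)%:R * (b == i)%:R) else 0 : R)).
  rewrite -sumrB; apply: eq_bigr => i _; rewrite -sumrB; apply: eq_bigr => j _.
  rewrite mulmxnE addmxE -[- ev j]scaleN1r -{2}[ev j]scale1r !Mx_evE.
  rewrite [j == i]eq_sym; case: (eqVneq i j) => [->|_] /=; rewrite ?mulr0n ?mulr1n; ring.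
under [X in _ - X]eq_bigr do rewrite -big_mkcond big_pred1_eq.
rewrite !dsumD dsum_l dsum_r -!mulr_sumr !sum_deltaE !mxE eq_sym /= -[in X in X%:R]addn1 natrD.
by ring.
Qed.

End Moments.

(** * Type A *)

Section Lift.
Variables (R : realType) (N k : nat) (E : 'M[R]_(k, N)).
Hypothesis EEt : E *m E^T = 1%:M.

Lemma liftE (H : 'M[R]_k) : conjmap E^T H = E^T *m H *m E.
Proof. by rewrite conjmapE trmxK. Qed.

Lemma lift_sym (H : 'M[R]_k) : H^T = H -> (E^T *m H *m E)^T = E^T *m H *m E.
Proof. by move=> SH; rewrite -liftE conj_sym. Qed.

Lemma liftEK (H : 'M[R]_k) : E *m (E^T *m H *m E) *m E^T = H.
Proof. by rewrite !mulmxA EEt mul1mx -mulmxA EEt mulmx1. Qed.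

Lemma mxtrace_lift (H : 'M[R]_k) : \tr (E^T *m H *m E) = \tr H.
Proof. by rewrite mxtrace_mulC mulmxA EEt mul1mx. Qed.

Lemma ip_lift (G H : 'M[R]_k) : ip (E^T *m G *m E) (E^T *m H *m E) = ip G H.
Proof.
by rewrite -[in RHS](liftEK H) -conjmapE ip_conj.
Qed.

Lemma lift_diag (H : 'M[R]_k) a : (E^T *m H *m E) a a = eval H (E *m ev R a).
Proof. by rewrite eval_mul /eval quad_ev. Qed.

End Lift.

Section TypeA.
Variables (R : realType) (k : nat) (E : 'M[R]_(k, k.+1)).
Hypothesis E_frame : frame (t := TypeA k) E.
Let EEt : E *m E^T = 1%:M := E_frame.1.
Let E_span := E_frame.2.
Local Notation Y := (root_system (t := TypeA k) E).
Local Notation N := (k.+1%:R : R).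
Local Notation ev := (ev R).
Local Notation lift H := (E^T *m H *m E).

Let N0 : N != 0. Proof. by rewrite pnatr_eq0. Qed.

Lemma rootsA_evB x : x \in rootsA R k ->
  exists i j, i != j /\ x = ev i - ev j.
Proof.
case/rootsAP => -[[i j] [c s]] [/= lij -> ->]; rewrite /signed_pair /=.
have ij : i != j by rewrite -val_eqE /= ltn_eqF.
case: s; rewrite ?expr1 ?expr0 ?scale1r !scaleN1r ?opprB.
  by exists j, i; rewrite eq_sym.
by exists i, j.
Qed.

Lemma mem_rootsA_evB i j : i != j -> ev i - ev j \in rootsA R k.
Proof.
rewrite -val_eqE neq_ltn => /orP[] l; apply/rootsAP.
  exists ((i, j), (true, false)).
  by rewrite /signed_pair /= expr1 expr0 scale1r scaleN1r.
exists ((j, i), (true, true)).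
by rewrite /signed_pair /= expr1 !scaleN1r opprB.
Qed.

Lemma dotv_ev q i j : dotv (ev (i : 'I_q)) (ev j) = (i == j)%:R.
Proof. by rewrite /dotv /Defs.ev trmx_delta mul_delta_mx_cond mulmxnE mxE !eqxx. Qed.

Lemma dotvBl q (x y z : 'cV[R]_q) : dotv (x - y) z = dotv x z - dotv y z.
Proof. by rewrite /dotv [(_ - _)^T]linearB mulmxBl !mxE. Qed.

Lemma dotvC q (x y : 'cV[R]_q) : dotv x y = dotv y x.
Proof. by rewrite /dotv -[in RHS](trmxK x) -trmx_mul [RHS]mxE. Qed.

Lemma dotvBr q (x y z : 'cV[R]_q) : dotv z (x - y) = dotv z x - dotv z y.
Proof. by rewrite dotvC dotvBl !(dotvC z). Qed.

Lemma rootA_norm x : x \in rootsA R k -> dotv x x = 2.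
Proof.
case/rootsA_evB => i [j [ij ->]].
rewrite !(dotvBl, dotvBr) !dotv_ev !eqxx (eq_sym j) (negPf ij) /= mulr0n mulr1n; ring.
Qed.

(** The orthogonal projection of R^(k+1) onto the complement of (1, ..., 1). *)
Let P : 'M[R]_k.+1 := 1%:M - N^-1 *: const_mx 1.

Lemma rootA_orth1 x : x \in rootsA R k -> (const_mx 1 : 'M_(1, k.+1)) *m x = 0.
Proof.
case/rootsA_evB => i [j [ij ->]].
by rewrite mulmxBr /Defs.ev -!colE; apply/matrixP => a b; rewrite !mxE subrr.
Qed.

Lemma rootA_proj x : x \in rootsA R k -> P *m x = x.
Proof.
move=> xX; rewrite mulmxBl mul1mx -scalemxAl.
have -> : const_mx 1 = const_mx 1 *m (const_mx 1 : 'M_(1, k.+1)) :> 'M[R]_k.+1.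
  by apply/matrixP => i j; rewrite !mxE big_ord_recl big_ord0 !mxE mulr1 addr0.
by rewrite -mulmxA rootA_orth1 // mulmx0 scaler0 subr0.
Qed.

Let P_sym : P^T = P.
Proof. by rewrite linearB linearZ /= trmx1 trmx_const. Qed.

Let twoN0 : 2 * N != 0. Proof. by rewrite mulf_neq0 ?pnatr_eq0. Qed.

Lemma frameA_proj : E^T *m E = P.
Proof.
by apply: (frame_proj EEt E_span P_sym twoN0 rootA_proj); apply: sum_Mx_rootsA.
Qed.

Lemma sum_Mx_A : \sum_(y <- Y) Mx y = (2 * N) *: 1%:M.
Proof.
by apply: (sum_Mx_frame EEt E_span P_sym twoN0 rootA_proj); apply: sum_Mx_rootsA.
Qed.

(** The roots are orthogonal to (1, ..., 1), so E kills that vector. This supplies the row condition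
    of [bilin_rootsA]. *)
Lemma lift_row0 (H : 'M[R]_k) i : \sum_j (lift H) i j = 0.
Proof.
have E1 : E *m const_mx 1 = 0 :> 'cV_k.
  apply: trmx_inj; rewrite trmx_mul trmx_const trmx0.
  exact: (frame_kill E_span) rootA_orth1.
have : (lift H) *m const_mx 1 = 0 :> 'cV_ _ by rewrite -mulmxA E1 mulmx0.
move/(congr1 (fun v : 'cV_ _ => v i 0)); rewrite [RHS]mxE mxE => e; rewrite -[RHS]e.
by apply: eq_bigr => j _; rewrite [const_mx _ _ _]mxE mulr1.
Qed.

Lemma bilin_A (G H : 'M[R]_k) : G^T = G -> H^T = H ->
  bilin Y G H = 4 * ip G H + 2 * \tr G * \tr H +
    2 * N * \sum_a (lift G) a a * (lift H) a a.
Proof.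
move=> SG SH; rewrite (bilin_frame EEt E_span) bilin_rootsA ?lift_sym //.
- by rewrite ip_lift // !mxtrace_lift.
- exact: lift_row0.
- exact: lift_row0.
Qed.

(** For k > 1 this is U_1(A_k), by [U1AE]. Being given by equations, it lets the eigenvalue and the
    orthogonality be read off from [bilin_A] and [ip_PA]. *)
Definition zero_diag_lift : {vspace 'M[R]_k} :=
  (symv R k :&: lker (linfun (@diag_of R k.+1 \o conjmap E^T)))%VS.

Lemma zero_diag_liftP H :
  reflect (H^T = H /\ forall a, (lift H) a a = 0) (H \in zero_diag_lift).
Proof.
rewrite memv_cap memv_ker lfunE /= liftE; apply: (iffP andP) => -[/symvP SH H0].
  by split=> // a; move/eqP/rowP/(_ a): H0; rewrite !mxE.
by split=> //; apply/eqP/rowP => a; rewrite mxE H0 mxE.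
Qed.

Lemma zero_diag_lift_traceless : (zero_diag_lift <= traceless R k)%VS.
Proof.
apply/subvP => H /zero_diag_liftP[SH H0]; apply/tracelessP; split=> //.
by rewrite -(mxtrace_lift EEt) /mxtrace big1.
Qed.

Lemma zero_diag_lift_eigsp : (zero_diag_lift <= eigsp Y 4)%VS.
Proof.
apply/subvP => H HZ; have [SH H0] := zero_diag_liftP _ HZ.
have /tracelessP[_ tH] := subvP zero_diag_lift_traceless H HZ.
apply/eigspP; split=> //; apply: formop_eigenP => // G /symvP SG.
by rewrite bilin_A // tH mulr0 big1 ?mulr0 ?addr0 // => a _; rewrite H0 mulr0.
Qed.

(** Up to the trace, pairing with P_i reads off the i-th diagonal entry of the lift. Hence U_2 is
    orthogonal to the traceless matrices whose lift has zero diagonal. *)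
Lemma ip_PA (G : 'M[R]_k) i : G^T = G ->
  ip G (PA E i) = N * (lift G) i i - \tr G.
Proof.
move=> SG; rewrite /PA linearB linear_sum /= ipZr {2}/ip mulmx1.
(* The term j = i, left out of P_i, is zero and may be added. *)
transitivity (\sum_j ((lift G) i i + (lift G) j j - 2 * (lift G) i j) - 2 * \tr G).
  congr (_ - _); rewrite [RHS](bigD1 i) //= [X in _ = X + _](_ : _ = 0); last by ring.
  rewrite add0r; apply: eq_bigr => j _.
  by rewrite -eval_ip eval_mul eval_evB // lift_sym.
rewrite sumrB big_split /= sumr_const card_ord -mulr_sumr lift_row0.
by rewrite -[X in _ + X - _ - _]/(\tr (lift G)) mxtrace_lift // -mulr_natl; ring.
Qed.

Lemma PA_sym i : (PA E i)^T = PA E i.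
Proof.
rewrite linearB linear_sum linearZ /= trmx1; congr (_ - _).
by apply: eq_bigr => j _; rewrite Mx_sym.
Qed.

(** The entry is the pairing of P_i with the rank one matrix of E e_a, which [ip_PA] evaluates to N
    P_ia^2 - P_aa for the projection P. *)
Lemma PA_diag i a : (lift (PA E i)) a a = (N - 2) * ((a == i)%:R - N^-1).
Proof.
rewrite lift_diag eval_ip ipC ip_PA ?Mx_sym // mxtrace_Mx.
have -> : dotv (E *m ev a) (E *m ev a) = P a a.
  rewrite -frameA_proj /dotv trmx_mul !mulmxA -[in LHS](mulmxA _ E^T).
  by rewrite quad_ev.
have -> : (lift (Mx (E *m ev a))) i i = P i a ^+ 2.
  rewrite Mx_mul conjmapE !mulmxA frameA_proj -mulmxA frameA_proj /Mx.
  rewrite -mulmxA /Defs.ev trmx_delta -colE -rowE mxE big_ord_recl big_ord0.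
  by rewrite !mxE addr0 (eq_sym i a) expr2.
rewrite !mxE !eqxx (eq_sym i a) !mulr1.
by case: (a == i); move: N N0 => M M0 /=; field.
Qed.

Lemma mxtrace_PA i : \tr (PA E i) = 0.
Proof.
rewrite -(mxtrace_lift EEt) /mxtrace.
under eq_bigr do rewrite PA_diag.
rewrite -mulr_sumr sumrB sumr_const card_ord.
rewrite (@big_only1 _ _ _ _ i) ?eqxx => [|//|a /negPf -> //].
by rewrite -(mulr_natl N^-1) mulfV // subrr mulr0.
Qed.

Lemma U2A_traceless : (U2A E <= traceless R k)%VS.
Proof.
apply/span_subvP => _ /imageP[i _ ->]; apply/tracelessP.
by rewrite PA_sym mxtrace_PA.
Qed.

(** At H = P_i the diagonal term of [bilin_A] is 2 (N - 2) <G, P_i>, and 4 + 2 (N - 2) = 2 N. *)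
Lemma U2A_eigsp : (U2A E <= eigsp Y (2 * N))%VS.
Proof.
apply/span_subvP => _ /imageP[i _ ->]; apply/eigspP; rewrite PA_sym; split=> //.
apply: formop_eigenP; first exact: PA_sym.
move=> G /symvP SG; rewrite bilin_A ?PA_sym // mxtrace_PA ip_PA //.
under eq_bigr do rewrite PA_diag mulrCA mulrBr.
rewrite -mulr_sumr sumrB.
under eq_bigr => a _ do rewrite mulrC (eq_sym a i).
rewrite (sum_deltaE i (fun a => (lift G) a a)) -mulr_suml.
rewrite -[X in _ - X * _]/(\tr (lift G)) mxtrace_lift //.
by move: N N0 (\tr G) ((lift G) i i) => M M0 x y; field.
Qed.

Lemma zero_diag_lift_orth_U2A A B :
  A \in zero_diag_lift -> B \in U2A E -> ip A B = 0.
Proof.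
move=> AZ; have [SA A0] := zero_diag_liftP _ AZ.
have /tracelessP[_ tA] := subvP zero_diag_lift_traceless A AZ.
suff /subvP s : (U2A E <= lker (linfun (ip A : 'M_k -> R^o)))%VS.
  by move=> /s; rewrite memv_ker lfunE => /eqP.
apply/span_subvP => _ /imageP[i _ ->]; rewrite memv_ker lfunE /=.
by rewrite ip_PA // A0 tA mulr0 subrr.
Qed.

Lemma traceless_small (H : 'M[R]_k) : (k <= 1)%N -> \tr H = 0 -> H = 0.
Proof.
move=> k1 tH; have k_all (a b : 'I_k) : a = b.
  have ord_eq0 (c : 'I_k) : val c = 0%N.
    by apply/eqP; rewrite -leqn0 -ltnS (leq_trans (ltn_ord c)).
  by apply/val_inj; rewrite !ord_eq0.
apply/matrixP => a b; rewrite mxE -tH (k_all b a) /mxtrace.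
by rewrite (@big_only1 _ _ _ _ a) // => c; rewrite (k_all c a) eqxx.
Qed.

Lemma traceless_sub_zero_diag : (1 < k)%N ->
  (traceless R k <= zero_diag_lift + U2A E)%VS.
Proof.
move=> k1; apply/subvP => H /tracelessP[SH tH].
have N2 : N - 2 != 0 by rewrite subr_eq0 eqr_nat eqSS gtn_eqF.
(* By [PA_diag] these coefficients give the lift of D the diagonal of the lift of H; the
   contributions of 1/N add up to the trace of H, which is zero. *)
pose D := \sum_i ((lift H) i i / (N - 2)) *: PA E i.
have UD : D \in U2A E.
  by apply: memv_suml => i _; apply: memvZ; apply: memv_span; apply: image_f.
rewrite -[H](subrK D); apply: memv_add => //; apply/zero_diag_liftP; split=> [|a].
  rewrite linearB linear_sum /= SH; congr (_ - _).
  by apply: eq_bigr => i _; rewrite linearZ /= PA_sym.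
rewrite -liftE linearB linear_sum /= addmxE oppmxE summxE liftE.
apply/eqP; rewrite subr_eq0; apply/eqP.
transitivity (\sum_i ((a == i)%:R * (lift H) i i - N^-1 * (lift H) i i)).
  rewrite sumrB sum_deltaE -mulr_sumr -[X in _ * X]/(\tr (lift H)) mxtrace_lift //.
  by rewrite tH mulr0 subr0.
apply: eq_bigr => i _; rewrite liftE -scalemxAr -scalemxAl [RHS]mxE PA_diag.
by rewrite -mulrBl mulrA divfK // mulrC.
Qed.

(* Averaging H over the products of orthogonal roots e_a - e_b, e_c - e_d gives a
   multiple of H.  Terms with a = b or c = d vanish, so that it suffices to
   exclude b = c, d = a and b = d from the sum. *)
Lemma alternating_quadruple_sum (H : 'M[R]_k.+1) :
  H^T = H -> (forall a, H a a = 0) -> (forall a, \sum_c H a c = 0) ->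
  \sum_a \sum_c \sum_(b | b != c) \sum_(d | (d != a) && (d != b))
     H a c *: ((ev a - ev b) *m (ev c - ev d)^T) =
  ((N - 1) * (N - 2)) *: H.
Proof.
move=> SH Hd Hr; apply/matrixP => p q.
pose x i : R := (p == i)%:R; pose y i : R := (q == i)%:R.
have x1 : \sum_i x i = 1.
  by rewrite -[RHS](sum_deltaE p (fun=> 1)); apply: eq_bigr => i _; rewrite mulr1.
have y1 : \sum_i y i = 1.
  by rewrite -[RHS](sum_deltaE q (fun=> 1)); apply: eq_bigr => i _; rewrite mulr1.
pose W a b c d := (x a - x b) * (y c - y d).
pose Z := \sum_i x i * y i.
(* The sum of W over d different from a and b, by removing two terms from the full sum. If a = b the
   same term is removed twice, but then W is zero. *)
pose K a c b := (x a - x b) * (N * y c - 1) - W a b c a - W a b c b.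
have WK a b c : \sum_(d | (d != a) && (d != b)) W a b c d = K a c b.
  case: (eqVneq a b) => [<-|ab].
    by rewrite /K /W subrr !mul0r !subr0 big1 // => d _; rewrite mul0r.
  have : \sum_d W a b c d = (x a - x b) * (N * y c - 1).
    by rewrite -mulr_sumr sumrB y1 sumr_const card_ord mulr_natl.
  rewrite (bigD1 a) //= (bigD1 b) 1?eq_sym //= /K => <-.
  by rewrite (addrC (W a b c a)) addrK addrC addrK.
have KT a c : \sum_(b | b != c) K a c b = \sum_b K a c b - K a c c.
  by rewrite [in RHS](bigD1 c) //= addrC addrK.
have sK a c : \sum_b K a c b = (N * x a - 1) * (N * y c - 1)
    - (N * x a - 1) * (y c - y a) - (N * (x a * y c) - x a - y c + Z).
  rewrite /K !sumrB; congr (_ - _ - _).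
  - rewrite -mulr_suml; congr (_ * _).
    by rewrite sumrB x1 sumr_const card_ord mulr_natl.
  - by rewrite /W -mulr_suml sumrB x1 sumr_const card_ord mulr_natl.
  transitivity (\sum_b (x a * y c - x a * y b - y c * x b + x b * y b)).
    by apply: eq_bigr => b _; rewrite /W; ring.
  rewrite big_split /= !sumrB sumr_const card_ord mulr_natl -!mulr_sumr x1 y1.
  by rewrite !mulr1.
(* U and V collect the coefficients of H_ac that depend on a alone or on c alone; they drop out
   because the rows of H sum to zero. What remains contributes N^2 - 3 N + 1 and 1, together (N - 1)
   (N - 2). *)
pose U a := - N * x a + N * (x a * y a) - y a + 2 * x a - x a * y a + 1 - Z.
pose V c := - N * y c + 2 * y c + N * (x c * y c) - x c - x c * y c.
transitivity (\sum_a \sum_c (H a c * ((N ^+ 2 - 3 * N + 1) * (x a * y c))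
    + H a c * (x c * y a) + U a * H a c + V c * H a c)).
  rewrite summxE; apply: eq_bigr => a _; rewrite summxE; apply: eq_bigr => c _.
  transitivity (H a c * \sum_(b | b != c) K a c b).
    rewrite summxE mulr_sumr; apply: eq_bigr => b _.
    rewrite summxE -WK mulr_sumr; apply: eq_bigr => d _.
    by rewrite mxE mxE big_ord_recl big_ord0 !mxE !eqxx !andbT addr0.
  by rewrite KT sK /K /W /U /V; ring.
rewrite !dsumD dsum_row // dsum_col // !addr0.
have S1 : \sum_a \sum_c H a c * ((N ^+ 2 - 3 * N + 1) * (x a * y c)) =
    (N ^+ 2 - 3 * N + 1) * H p q.
  rewrite -[in RHS](sum_deltaE p (fun i => H i q)) mulr_sumr.
  apply: eq_bigr => a _; rewrite -(sum_deltaE q (H a)) !mulr_sumr.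
  by apply: eq_bigr => c _; rewrite /x /y; ring.
have S2 : \sum_a \sum_c H a c * (x c * y a) = H p q.
  rewrite -{1}SH -[RHS](sum_deltaE q (H p)); apply: eq_bigr => a _.
  rewrite -(sum_deltaE p (fun i => H i a)) mulr_sumr.
  by apply: eq_bigr => c _; rewrite mxE /x /y; ring.
by rewrite S1 S2 mxE; ring.
Qed.

(** Orthogonal roots have disjoint supports: a shared index contributes 1 or -1 to the product, and
    cancelling it by another would make two indices of the same root coincide. *)
Lemma rootA_disjoint u v a : u \in rootsA R k -> v \in rootsA R k ->
  dotv u v = 0 -> u a 0 * v a 0 = 0.
Proof.
case/rootsA_evB => i [j [ij ->]] /rootsA_evB[l [r [lr ->]]].
rewrite !(dotvBl, dotvBr) !dotv_ev !mxE !eqxx !andbT => uv0.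
have {uv0} : ((i == l) + (j == r) = (j == l) + (i == r))%N.
  by apply/eqP; rewrite -(eqr_nat R) !natrD -subr_eq0 -uv0; apply/eqP; ring.
case: (eqVneq i l) => e1; case: (eqVneq i r) => e2;
  case: (eqVneq j l) => e3; case: (eqVneq j r) => e4 //= _;
  try solve [by case/eqP: ij; congruence | by case/eqP: lr; congruence].
case: (eqVneq a i) => [->|ai]; first by rewrite (negPf e1) (negPf e2) subrr mulr0.
case: (eqVneq a j) => [->|aj]; first by rewrite (negPf e3) (negPf e4) subrr mulr0.
by rewrite subrr mul0r.
Qed.

(** The lift of a generator is u v^T + v u^T for roots u, v of disjoint support, so its diagonal is
    zero. *)
Lemma U1A_sub : (U1A E <= zero_diag_lift)%VS.
Proof.
apply/span_subvP => _ /mapP[[x y] + ->]; rewrite mem_filter /=.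
case/andP => /eqP xy0 /allpairsP[[x' y'] /= [xY yY [ex ey]]].
move: xY yY xy0; rewrite -{}ex -{}ey {x' y'} => + + xy0.
case/imfsetP => u /= uX ex /imfsetP[v /= vX ey]; subst x y.
move: xy0; rewrite /dotv trmx_mul -mulmxA (frame_rootK EEt E_span) // => uv0.
apply/zero_diag_liftP; split=> [|a].
  by rewrite /Mxy linearD /= !trmx_mul !trmxK addrC.
have lift_outer (u' v' : 'cV_k.+1) : u' \in rootsA R k -> v' \in rootsA R k ->
    lift ((E *m u') *m (E *m v')^T) = u' *m v'^T.
  move=> uX' vX'.
  transitivity ((E^T *m (E *m u')) *m (E^T *m (E *m v'))^T).
    by rewrite !trmx_mul !trmxK !mulmxA.
  by rewrite !(frame_rootK EEt E_span).
rewrite /Mxy mulmxDr mulmxDl !lift_outer // addmxE.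
have mE (u' v' : 'cV[R]_k.+1) : (u' *m v'^T) a a = u' a 0 * v' a 0.
  by rewrite mxE big_ord_recl big_ord0 addr0 mxE.
by rewrite !mE (mulrC (v a 0)) (rootA_disjoint a uX vX uv0) addr0.
Qed.

(** The averaging identity for the lift of H, added to its transpose, writes 2 (N - 1) (N - 2) H in
    the generators; the factor is nonzero as k > 1. *)
Lemma sub_U1A : (1 < k)%N -> (zero_diag_lift <= U1A E)%VS.
Proof.
move=> k1; apply/subvP => H /zero_diag_liftP[SH H0].
have c0 : (N - 1) * (N - 2) *+ 2 != 0.
  rewrite mulrn_eq0 mulf_eq0 !subr_eq0 pnatr_eq1 eqr_nat !eqSS negb_or.
  by move: k1; case: (k) => [|[]].
have outer (u v : 'cV[R]_k.+1) : E *m (u *m v^T) *m E^T = (E *m u) *m (E *m v)^T.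
  by rewrite trmx_mul !mulmxA.
pose S := \sum_a \sum_c \sum_(b | b != c) \sum_(d | (d != a) && (d != b))
  (lift H) a c *: Mxy (E *m (ev a - ev b)) (E *m (ev c - ev d)).
suff SE : S = ((N - 1) * (N - 2) *+ 2) *: H.
  rewrite -[H](scalerK c0) -SE; apply: memvZ.
  apply: memv_suml => a _; apply: memv_suml => c _.
  apply: memv_suml => b bc; apply: memv_suml => d /andP[da db].
  (* Terms with a = c, a = b or c = d are zero. In all others the four indices are distinct, so the
     two roots are orthogonal. *)
  case: (eqVneq a c) => [<-|ac]; first by rewrite H0 scale0r mem0v.
  apply: memvZ; case: (eqVneq a b) => [<-|ab].
    by rewrite /Mxy subrr mulmx0 mul0mx trmx0 mulmx0 addr0 mem0v.
  case: (eqVneq c d) => [<-|cd].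
    by rewrite /Mxy subrr mulmx0 mul0mx trmx0 mulmx0 addr0 mem0v.
  apply: memv_span; apply/mapP.
  exists (E *m (ev a - ev b), E *m (ev c - ev d)) => //.
  rewrite mem_filter /=; apply/andP; split.
    rewrite /dotv trmx_mul -mulmxA (frame_rootK EEt E_span) ?mem_rootsA_evB //.
    rewrite -/(dotv _ _) !(dotvBl, dotvBr) !dotv_ev (eq_sym a d).
    by rewrite (negPf ac) (negPf da) (negPf bc) (eq_sym b d) (negPf db) /= !subr0.
  by apply/allpairsP; exists (E *m (ev a - ev b), E *m (ev c - ev d));
    split=> //; apply: in_imfset; apply: mem_rootsA_evB.
(* The unsymmetrised half of S: the sum S is T plus its transpose, and T is a multiple of the
   symmetric H. *)
pose T := \sum_a \sum_c \sum_(b | b != c) \sum_(d | (d != a) && (d != b))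
  (lift H) a c *: (E *m ((ev a - ev b) *m (ev c - ev d)^T) *m E^T).
have TE : T = ((N - 1) * (N - 2)) *: H.
  rewrite -[H in RHS](liftEK EEt) scalemxAl scalemxAr.
  rewrite -(alternating_quadruple_sum (lift_sym E SH) H0 (lift_row0 H)).
  do 4![rewrite mulmx_sumr mulmx_suml; apply: eq_bigr => ? _].
  by rewrite -scalemxAr -scalemxAl.
rewrite mulr2n scalerDl -{2}SH -!linearZ /= -TE.
rewrite /S /T [X in _ = _ + X]linear_sum -big_split; apply: eq_bigr => a _ /=.
do 3![rewrite [X in _ = _ + X]linear_sum -big_split; apply: eq_bigr => ? _ /=].
rewrite [X in _ = _ + X]linearZ /= -scalerDr /Mxy; congr (_ *: (_ + _)); rewrite !outer //.
by rewrite [RHS]trmx_mul trmxK.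
Qed.

Lemma U1AE : (1 < k)%N -> U1A E = zero_diag_lift.
Proof. by move=> k1; apply/eqP; rewrite eqEsubv U1A_sub sub_U1A. Qed.

(** At k = 1 the factors N - 2 used above vanish, but then no nonzero matrix is traceless. *)
Lemma traceless_subA : (traceless R k <= U1A E + U2A E)%VS.
Proof.
case: (ltnP 1 k) => [k1|k1]; first by rewrite U1AE // traceless_sub_zero_diag.
by apply/subvP => H /tracelessP[_ /(traceless_small k1) ->]; apply: mem0v.
Qed.

End TypeA.

(** * Type D *)

Section TypeD.
Variables (R : realType) (k : nat) (E : 'M[R]_k).
Hypothesis k_gt0 : (0 < k)%N.
Hypothesis E_frame : frame (t := TypeD k) E.
Let EEt : E *m E^T = 1%:M := E_frame.1.
Let E_span := E_frame.2.
(** The roots of D_k live in R^k itself, so E is a square orthogonal matrix and lifting is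
    invertible. *)
Let EtE : E^T *m E = 1%:M := mulmx1C EEt.
Local Notation Y := (root_system (t := TypeD k) E).
Local Notation K := (k%:R : R).
Local Notation lift H := (E^T *m H *m E).

Lemma dotv_Mx q (x : 'cV[R]_q) : dotv x x = \sum_a Mx x a a.
Proof. by rewrite -mxtrace_Mx. Qed.

Lemma rootD_norm x : x \in rootsD R k -> dotv x x = 2.
Proof.
case/rootsDP => -[[i j] [c s]] /= lij ->.
have ij : i == j = false by rewrite -val_eqE /= ltn_eqF.
have sgn (b : bool) : (-1) ^+ b * (-1) ^+ b = 1 :> R by case: b; rewrite ?expr1 ?expr0; ring.
rewrite dotv_Mx (eq_bigr (fun a => (a == i)%:R + (a == j)%:R)).
  rewrite big_split /= (@big_only1 _ _ _ _ i) ?(@big_only1 _ _ _ _ j) ?eqxx //.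
    by move=> a /negPf ->.
  by move=> a /negPf ->.
move=> a _; rewrite /Mx mxE big_ord_recl big_ord0 [_^T _ _]mxE signed_pairE /=.
case: (eqVneq a i) => [->|_]; rewrite ?ij; last case: (a == j);
  rewrite /= ?mulr0n ?mulr1n ?mulr0 ?addr0 ?add0r ?mulr1 ?sgn //.
  by rewrite mulrACA !sgn mulr1.
by rewrite mulr0 mul0r.
Qed.

Lemma sum_Mx_D : \sum_(y <- Y) Mx y = (2 * (2 * (k.-1)%:R)) *: 1%:M.
Proof.
rewrite (big_frame EEt E_span) /=.
under eq_bigr do rewrite Mx_mul.
by rewrite -linear_sum sum_Mx_rootsD // linearZ /= conjmapE mulmx1 EEt.
Qed.

Lemma bilin_D (G H : 'M[R]_k) : G^T = G -> H^T = H ->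
  bilin Y G H = 8 * ip G H + 4 * \tr G * \tr H +
    (4 * K - 16) * \sum_a (lift G) a a * (lift H) a a.
Proof.
move=> SG SH; rewrite (bilin_frame EEt E_span) bilin_rootsD ?lift_sym //.
by rewrite ip_lift // !mxtrace_lift.
Qed.

Lemma lift_conj (M : 'M[R]_k) : lift (conjmap E M) = M.
Proof. by rewrite conjmapE !mulmxA EtE mul1mx -mulmxA EtE mulmx1. Qed.

Lemma U1DP H : reflect (H^T = H /\ forall a, (lift H) a a = 0) (H \in U1D E).
Proof.
apply: (iffP memv_imgP) => [[M /std_U1DP[SM M0] ->]|[SH H0]].
  by rewrite conj_sym // lift_conj.
exists (lift H); last by rewrite conjmapE liftEK.
by apply/std_U1DP; split=> //; apply: lift_sym.
Qed.

Lemma U2DP H :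
  reflect (exists2 d : 'rV[R]_k, \sum_i d 0 i = 0 & lift H = diag_mx d)
          (H \in U2D E).
Proof.
apply: (iffP memv_imgP) => [[M /std_U2DP[d d0 ->] ->]|[d d0 Hd]].
  by exists d; rewrite // lift_conj.
exists (lift H); last by rewrite conjmapE liftEK.
by rewrite Hd; apply/std_U2DP; exists d.
Qed.

Lemma U1D_traceless : (U1D E <= traceless R k)%VS.
Proof.
apply/subvP => H /U1DP[SH H0]; apply/tracelessP; split=> //.
by rewrite -(mxtrace_lift EEt) /mxtrace big1.
Qed.

Lemma U2D_traceless : (U2D E <= traceless R k)%VS.
Proof.
apply/subvP => H /U2DP[d d0 Hd]; apply/tracelessP.
rewrite -(liftEK EEt H) -conjmapE Hd conj_sym ?tr_diag_mx //; split=> //.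
by rewrite -(mxtrace_lift EEt) lift_conj mxtrace_diag.
Qed.

Lemma U1D_eigsp : (U1D E <= eigsp Y 8)%VS.
Proof.
apply/subvP => H HU; have [SH H0] := U1DP _ HU.
have /tracelessP[_ tH] := subvP U1D_traceless H HU.
apply/eigspP; split=> //; apply: formop_eigenP => // G /symvP SG.
by rewrite bilin_D // tH mulr0 big1 ?mulr0 ?addr0 // => a _; rewrite H0 mulr0.
Qed.

Lemma ip_U2D (G H : 'M[R]_k) d : lift H = diag_mx d ->
  ip G H = \sum_a (lift G) a a * d 0 a.
Proof.
move=> Hd; rewrite -(ip_lift EEt) Hd ip_sum ?tr_diag_mx //.
apply: eq_bigr => a _; rewrite (@big_only1 _ _ _ _ a) ?[diag_mx _ _ _]mxE ?eqxx //.
by move=> b /negPf ba _; rewrite [diag_mx _ _ _]mxE eq_sym ba mulr0n mulr0.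
Qed.

(** For a diagonal lift the last term of [bilin_D] is (4 k - 16) <G, H>, and 8 + 4 k - 16 = 2 h - 4
    with h = 2 (k - 1). *)
Lemma U2D_eigsp : (U2D E <= eigsp Y (2 * (2 * (k.-1)%:R) - 4))%VS.
Proof.
apply/subvP => H HU; have [d d0 Hd] := U2DP _ HU.
have /tracelessP[SH tH] := subvP U2D_traceless H HU.
apply/eigspP; split=> //; apply: formop_eigenP => // G /symvP SG.
have -> : (k.-1)%:R = K - 1 by rewrite -subn1 natrB.
rewrite bilin_D // tH mulr0 Hd (ip_U2D _ Hd).
under [X in _ + _ * X]eq_bigr do rewrite [diag_mx _ _ _]mxE eqxx mulr1n.
by ring.
Qed.

Lemma U1D_orth_U2D A B : A \in U1D E -> B \in U2D E -> ip A B = 0.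
Proof.
move=> /U1DP[SA A0] /U2DP[d d0 Bd]; rewrite (ip_U2D _ Bd) big1 // => a _.
by rewrite A0 mul0r.
Qed.

Lemma traceless_subD : (traceless R k <= U1D E + U2D E)%VS.
Proof.
apply/subvP => H /tracelessP[SH tH].
pose d : 'rV[R]_k := \row_a (lift H) a a.
have dU : conjmap E (diag_mx d) \in U2D E.
  apply/U2DP; exists d; rewrite ?lift_conj // -[RHS]tH -(mxtrace_lift EEt).
  by apply: eq_bigr => a _; rewrite mxE.
rewrite -[H](subrK (conjmap E (diag_mx d))); apply: memv_add => //.
apply/U1DP; split=> [|a].
  by rewrite linearB /= SH conj_sym ?tr_diag_mx.
by rewrite mulmxBr mulmxBl lift_conj addmxE oppmxE !mxE eqxx mulr1n subrr.
Qed.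

End TypeD.

(** * Type E *)

Section IntegerRoots.
Local Open Scope Z_scope.

Definition sgnZ (b : bool) : Z := if b then -1 else 1.

Definition vecD (ij : nat * nat) (cs : bool * bool) : seq Z :=
  mkseq (fun l => sgnZ cs.2 * ((if l == ij.1 then 2 else 0) +
                               sgnZ cs.1 * (if l == ij.2 then 2 else 0))) 8.

Definition listD8 : seq (seq Z) :=
  [seq vecD ij cs |
    ij <- [seq ij <- [seq (i, j) | i <- iota 0 8, j <- iota 0 8] | (ij.1 < ij.2)%N],
    cs <- [seq (c, s) | c <- [:: false; true], s <- [:: false; true]]].

Fixpoint bitseqs (n : nat) : seq bitseq :=
  if n is n'.+1 then map (cons false) (bitseqs n') ++ map (cons true) (bitseqs n')
  else [:: [::]].

Definition list_half : seq (seq Z) :=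
  [seq map sgnZ b | b <- [seq b <- bitseqs 8 | ~~ odd (count id b)]].

(* The roots of E_8, E_7, E_6, with coordinates doubled. *)
Definition listE8 : seq (seq Z) := listD8 ++ list_half.
Definition listE7 : seq (seq Z) := [seq v <- listE8 | nth 0 v 6 =? nth 0 v 7].
Definition listE6 : seq (seq Z) := [seq v <- listE7 | nth 0 v 5 =? nth 0 v 6].

Definition sumZ T (s : seq T) (f : T -> Z) : Z := foldr (fun x z => f x + z) 0 s.

(* [d] times the orthogonal projection of R^8 onto the subspace where the last
   [d] coordinates are equal. *)
Definition projZ (d i j : nat) : Z :=
  if (i + d < 8)%N || (j + d < 8)%N then (if i == j then Z.of_nat d else 0) else 1.

(** In this and the next two checks, doubled coordinates multiply the squared length 2 and the
    second moments 2 h P by 4, and the fourth moments by 16. The factors d and d^2 clear the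
    denominators of P. *)
Definition vector_ok (d : nat) (v : seq Z) : bool :=
  [&& size v == 8%N, sumZ (iota 0 8) (fun i => nth 0 v i * nth 0 v i) =? 8 &
    all (fun i => sumZ (iota 0 8) (fun j => projZ d i j * nth 0 v j) =?
                  Z.of_nat d * nth 0 v i) (iota 0 8)].

Definition moment2_ok (L : seq (seq Z)) (d : nat) (h : Z) (i j : nat) : bool :=
  Z.of_nat d * sumZ L (fun v => nth 0 v i * nth 0 v j) =? 8 * h * projZ d i j.

Definition moment4_ok (L : seq (seq Z)) (d : nat) (c : Z) (i j k l : nat) : bool :=
  Z.of_nat d * Z.of_nat d *
    sumZ L (fun v => nth 0 v i * nth 0 v j * (nth 0 v k * nth 0 v l)) =?
  16 * c * (projZ d i j * projZ d k l +
            (projZ d i k * projZ d j l + projZ d i l * projZ d j k)).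

(** Fourth moments are symmetric in their indices, so only i <= j <= k <= l is tested: 330 instead
    of 4096 cases. *)
Definition design_ok (L : seq (seq Z)) (d : nat) (h c : Z) : bool :=
  [&& uniq L, all (vector_ok d) L,
    all (fun i => all (moment2_ok L d h i) (iota 0 8)) (iota 0 8) &
    all (fun i => all (fun j => all (fun k => all
      (moment4_ok L d c i j k)
      (iota k (8 - k))) (iota j (8 - j))) (iota i (8 - i))) (iota 0 8)].

(** The numbers are d, h and c. Contracting two indices of the fourth moment and comparing with the
    second forces c (k + 2) = 4 h, whence 12, 8 and 6. *)
Lemma design_E8 : design_ok listE8 1 30 12. Proof. by vm_compute. Qed.
Lemma design_E7 : design_ok listE7 2 18 8. Proof. by vm_compute. Qed.
Lemma design_E6 : design_ok listE6 3 12 6. Proof. by vm_compute. Qed.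

End IntegerRoots.

Lemma mem_bitseqs n b : (b \in bitseqs n) = (size b == n).
Proof.
elim: n b => [|n IH] [|x b] //=; rewrite mem_cat.
  by apply/orP => -[] /mapP[].
have inj c : injective (cons c : bitseq -> bitseq) by move=> u v [].
have neq c d : c != d -> (c :: b \in map (cons d) (bitseqs n)) = false.
  by move=> cd; apply/negP => /mapP[u _ [/eqP]]; rewrite (negPf cd).
by case: x; rewrite ?(neq true false isT) ?(neq false true isT) ?(mem_map (inj _)) IH ?orbF.
Qed.

(** Insertion sort by adjacent swaps. It extends the tested fourth moments to all orders of the
    indices. *)
Lemma sorted4_ind (Q : nat -> nat -> nat -> nat -> Prop) :
  (forall i j k l, Q j i k l -> Q i j k l) ->
  (forall i j k l, Q i k j l -> Q i j k l) ->
  (forall i j k l, Q i j l k -> Q i j k l) ->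
  (forall i j k l, (i <= j)%N -> (j <= k)%N -> (k <= l)%N -> Q i j k l) ->
  forall i j k l, Q i j k l.
Proof.
move=> s12 s23 s34 H0.
have H1 i j k l : (j <= k)%N -> (k <= l)%N -> Q i j k l.
  move=> jk kl; case: (leqP i j) => [ij|/ltnW ji]; first exact: H0.
  apply: s12; case: (leqP i k) => [ik|/ltnW ki]; first exact: H0.
  apply: s23; case: (leqP i l) => [il|/ltnW li]; first exact: H0.
  by apply: s34; apply: H0.
have H2 i j k l : (k <= l)%N -> Q i j k l.
  move=> kl; case: (leqP j k) => [jk|/ltnW kj]; first exact: H1.
  apply: s23; case: (leqP j l) => [jl|/ltnW lj]; first exact: H1.
  by apply: s34; apply: H1.
move=> i j k l; case: (leqP k l) => [kl|/ltnW lk]; first exact: H2.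
by apply: s34; apply: H2.
Qed.

Section TypeE.
Variable R : realType.
Local Notation ev := (ev R).

(** Binary integers make the finite check fast; this embedding transports its equations to R. *)
Definition zr (z : Z) : R := (int_of_Z z)%:~R.

Lemma zrD x y : zr (Z.add x y) = zr x + zr y.
Proof. by rewrite /zr -[Z.add x y]/(x + y)%R rmorphD intrD. Qed.

Lemma zrM x y : zr (Z.mul x y) = zr x * zr y.
Proof. by rewrite /zr -[Z.mul x y]/(x * y)%R rmorphM intrM. Qed.

Lemma zr_nat n : zr (Z.of_nat n) = n%:R.
Proof. by rewrite /zr (Z_of_intK (Posz n)). Qed.

Lemma zr_inj : injective zr.
Proof. by move=> x y /intr_inj /(can_inj int_of_ZK). Qed.

Lemma zr_sum T (s : seq T) f : zr (sumZ s f) = \sum_(x <- s) zr (f x).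
Proof. by elim: s => [|x s IH]; rewrite ?big_nil // big_cons -IH -zrD. Qed.

Lemma zr_sgn b : zr (sgnZ b) = (-1) ^+ b.
Proof. by case: b. Qed.

Definition half_vec (v : seq Z) : 'cV[R]_8 := \col_(i < 8) (zr (nth Z0 v i) / 2).

Lemma half_vec_inj :
  {in [pred v | size v == 8%N] &, injective half_vec}.
Proof.
move=> u v /eqP su /eqP sv e; apply: (@eq_from_nth _ Z0); rewrite su ?sv // => i i8.
have := congr1 (fun w : 'cV_8 => w (Ordinal i8) 0) e; rewrite !mxE.
have two0 : 2^-1 != 0 :> R by rewrite invr_eq0 pnatr_eq0.
by move/(mulIf two0)/zr_inj.
Qed.

Lemma half_vecD (i : sidx 8) :
  half_vec (vecD (val i.1.1, val i.1.2) i.2) = signed_pair R i.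
Proof.
apply/colP => l; rewrite mxE signed_pairE nth_mkseq // zrM zrD zrM !zr_sgn /=.
rewrite -mulrA; congr (_ * _); rewrite !val_eqE mulrDl -mulrA.
have z0 : zr Z0 = 0 by [].
have z2 : zr (Zpos (xO xH)) = 2 by [].
by congr (_ + _ * _); case: eqP => _; rewrite ?z0 ?z2 ?mul0r ?divff ?pnatr_eq0.
Qed.

Lemma mem_rootsD8 x : (x \in rootsD R 8) = (x \in map half_vec listD8).
Proof.
apply/rootsDP/mapP => [[i li ->]|[v]].
  exists (vecD (val i.1.1, val i.1.2) i.2); last by rewrite half_vecD.
  apply/allpairsP; exists ((val i.1.1, val i.1.2), i.2); split=> //.
    rewrite mem_filter; apply/andP; split=> //; apply/allpairsP; exists (val i.1.1, val i.1.2).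
    by rewrite !mem_iota /= !add0n !ltn_ord.
  by case: (i.2) => [[] []].
case/allpairsP => -[[a b] cs] [+ _ ->] ->.
rewrite mem_filter => /andP[lab].
case/allpairsP => -[a' b'] [+ + [ea eb]].
rewrite !mem_iota !add0n /= -{}ea -{}eb => a8 b8.
by exists ((Ordinal a8, Ordinal b8), cs); rewrite // -half_vecD.
Qed.

Lemma half_vec_sgn (b : bitseq) (s : {set 'I_8}) : size b = 8%N ->
  (forall i, (i \in s) = nth false b (val i)) ->
  half_vec (map sgnZ b) = 2^-1 *: \sum_(i < 8) (-1) ^+ (i \in s) *: ev i.
Proof.
move=> b8 sb; apply/colP => l; rewrite mxE (nth_map false) ?b8 // zr_sgn -sb.
rewrite mxE mulrC; congr (_ * _); rewrite summxE (@big_only1 _ _ _ _ l) // => [|i li _].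
  by rewrite !mxE !eqxx mulr1.
by rewrite !mxE eq_sym (negPf li) mulr0.
Qed.

Lemma mem_half_vectors x :
  (x \in half_vectors R) = (x \in map half_vec list_half).
Proof.
pose sb (s : {set 'I_8}) := [seq i \in s | i <- enum 'I_8].
have sbE (s : {set 'I_8}) (i : 'I_8) : (i \in s) = nth false (sb s) (val i).
  by rewrite (nth_map i) ?size_enum_ord ?ltn_ord // nth_ord_enum.
have ssb s : size (sb s) = 8%N by rewrite size_map size_enum_ord.
have csb s : count id (sb s) = #|s|.
  by rewrite count_map cardE size_filter -enumT; apply: eq_count.
apply/imfsetP/mapP => /= [[s +] ->|[v + ->]].
  rewrite inE => os; exists (map sgnZ (sb s)); last by rewrite (half_vec_sgn (s := s)).
  by rewrite map_f // mem_filter csb os mem_bitseqs ssb.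
case/mapP => b; rewrite mem_filter mem_bitseqs => /andP[ob /eqP b8] ->.
pose s := [set i : 'I_8 | nth false b (val i)].
have es : sb s = b.
  apply: (@eq_from_nth _ false); rewrite ssb ?b8 // => i i8.
  by rewrite -(sbE s (Ordinal i8)) inE.
exists s; first by rewrite inE -csb es.
by apply: half_vec_sgn => // i; rewrite inE.
Qed.

Lemma mem_rootsE8 x : (x \in rootsE8 R) = (x \in map half_vec listE8).
Proof. by rewrite in_fsetU mem_rootsD8 mem_half_vectors [in RHS]map_cat mem_cat. Qed.

Lemma dotv_evB (v : seq Z) (i j : 'I_8) :
  (dotv (half_vec v) (ev i - ev j) == 0) = Z.eqb (nth Z0 v i) (nth Z0 v j).
Proof.
have dE l : dotv (half_vec v) (ev l) = zr (nth Z0 v l) / 2.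
  by rewrite dotvC /dotv /Defs.ev trmx_delta -rowE !mxE.
rewrite dotvBr !dE -mulrBl mulf_eq0 invr_eq0 pnatr_eq0 orbF subr_eq0.
by apply/eqP/idP => [/zr_inj ->|/Z.eqb_eq ->]; rewrite ?Z.eqb_refl.
Qed.

Lemma mem_filter_dotv (X : {fset 'cV[R]_8}) (L : seq (seq Z)) (i j : 'I_8) x :
  X =i map half_vec L ->
  (x \in [fset x in X | dotv x (ev i - ev j) == 0]%fset) =
  (x \in map half_vec [seq v <- L | Z.eqb (nth Z0 v i) (nth Z0 v j)]).
Proof.
move=> XL; rewrite !inE /= XL; apply/andP/mapP => [[/mapP[v vL ->] d0]|[v + ->]].
  by exists v; rewrite // mem_filter vL -dotv_evB d0.
by rewrite mem_filter => /andP[e vL]; rewrite map_f // dotv_evB.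
Qed.

Lemma mem_rootsE7 x : (x \in rootsE7 R) = (x \in map half_vec listE7).
Proof. by rewrite (mem_filter_dotv _ _ _ mem_rootsE8) !inordK. Qed.

Lemma mem_rootsE6 x : (x \in rootsE6 R) = (x \in map half_vec listE6).
Proof. by rewrite (mem_filter_dotv _ _ _ mem_rootsE7) !inordK. Qed.

Definition projE (d : nat) : 'M[R]_8 := \matrix_(i, j) (zr (projZ d i j) / d%:R).

Lemma projE_sym d : (projE d)^T = projE d.
Proof. by apply/matrixP => i j; rewrite !mxE /projZ orbC eq_sym. Qed.

Section Design.
Variables (X : {fset 'cV[R]_8}) (L : seq (seq Z)) (d : nat) (h c : Z).
Hypothesis d_gt0 : (0 < d)%N.
Hypothesis XL : X =i map half_vec L.
Hypothesis LD : design_ok L d h c.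
Let d0 : d%:R != 0 :> R. Proof. by rewrite pnatr_eq0 -lt0n. Qed.

Lemma design_vector v : v \in L -> vector_ok d v.
Proof. by case/and4P: LD => _ /allP ok _ _ /ok. Qed.

Lemma zr_sum_ord (f : nat -> Z) : zr (sumZ (iota 0 8) f) = \sum_(i < 8) zr (f i).
Proof. by rewrite zr_sum -[iota 0 8]/(index_iota 0 8) big_mkord. Qed.

Lemma design_norm x : x \in X -> dotv x x = 2.
Proof.
rewrite XL => /mapP[v /design_vector/and3P[_ /Z.eqb_eq n8 _] ->].
have {}n8 : \sum_(i < 8) zr (nth Z0 v i) * zr (nth Z0 v i) = 8.
  by have := congr1 zr n8; rewrite zr_sum_ord; under eq_bigr do rewrite zrM.
have -> : 2 = 8 / 4 :> R by field.
rewrite -n8 mulr_suml /dotv mxE; apply: eq_bigr => i _.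
by rewrite !mxE; field.
Qed.

Lemma design_proj x : x \in X -> projE d *m x = x.
Proof.
rewrite XL => /mapP[v /design_vector/and3P[_ _ /allP ok] ->].
apply/colP => i; have /ok/Z.eqb_eq/(congr1 zr) : val i \in iota 0 8.
  by rewrite mem_iota add0n ltn_ord.
rewrite zr_sum_ord zrM zr_nat => e.
apply: (mulfI d0); rewrite [half_vec v i 0]mxE mulrA -e mulr_suml mxE mulr_sumr.
by apply: eq_bigr => j _; rewrite !mxE zrM; field.
Qed.

Lemma big_design (V : nmodType) (F : 'cV[R]_8 -> V) :
  \sum_(x <- X) F x = \sum_(v <- L) F (half_vec v).
Proof.
rewrite (big_fset_seq _ _ XL) ?big_map // map_inj_in_uniq; first by case/and4P: LD.
move=> u v /design_vector/and3P[su _ _] /design_vector/and3P[sv _ _].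
exact: half_vec_inj.
Qed.

Lemma sum_Mx_design : \sum_(x <- X) Mx x = (2 * zr h) *: projE d.
Proof.
rewrite big_design; apply/matrixP => i j; rewrite summxE !mxE.
have /and4P[_ _ /allP ok _] := LD.
have /ok/allP okj : val i \in iota 0 8 by rewrite mem_iota add0n ltn_ord.
have /okj/Z.eqb_eq/(congr1 zr) : val j \in iota 0 8 by rewrite mem_iota add0n ltn_ord.
rewrite !zrM zr_nat zr_sum; under eq_bigr do rewrite zrM.
have -> : zr (Zpos (xO (xO (xO xH)))) = 8 by [].
move=> e; transitivity ((\sum_(v <- L) zr (nth Z0 v i) * zr (nth Z0 v j)) / 4).
  rewrite mulr_suml; apply: eq_bigr => v _.
  by rewrite /Mx mxE big_ord_recl big_ord0 !mxE; field.
rewrite -[X in X / 4](mulKf d0) e; field.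
exact: d0.
Qed.

Lemma moment4_design (i j k l : 'I_8) :
  \sum_(v <- L) half_vec v i 0 * half_vec v j 0 * (half_vec v k 0 * half_vec v l 0) =
  zr c * (projE d i j * projE d k l +
          (projE d i k * projE d j l + projE d i l * projE d j k)).
Proof.
pose z v i := zr (nth Z0 v i); pose q i j := zr (projZ d i j).
have qC a b : q a b = q b a by rewrite /q /projZ orbC eq_sym.
have ok a b e f : (a < 8)%N -> (b < 8)%N -> (e < 8)%N -> (f < 8)%N ->
    d%:R * d%:R * (\sum_(v <- L) z v a * z v b * (z v e * z v f)) =
    16 * zr c * (q a b * q e f + (q a e * q b f + q a f * q b e)).
  move: a b e f; apply: sorted4_ind => a b e f.
  - move=> IH a8 b8 e8 f8.
    rewrite (eq_bigr (fun v => z v b * z v a * (z v e * z v f))) => [|v _]; last by ring.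
    by rewrite IH // (qC b a); ring.
  - move=> IH a8 b8 e8 f8.
    rewrite (eq_bigr (fun v => z v a * z v e * (z v b * z v f))) => [|v _]; last by ring.
    by rewrite IH // (qC e b); ring.
  - move=> IH a8 b8 e8 f8.
    rewrite (eq_bigr (fun v => z v a * z v b * (z v f * z v e))) => [|v _]; last by ring.
    by rewrite IH // (qC f e); ring.
  move=> ab be ef a8 b8 e8 f8; have /and4P[_ _ _ /allP ok] := LD.
  have in_iota x y : (x <= y)%N -> (y < 8)%N -> y \in iota x (8 - x).
    by move=> xy y8; rewrite mem_iota xy subnKC // (leq_trans xy (ltnW y8)).
  have /ok/allP/(_ _ (in_iota _ _ ab b8)) : a \in iota 0 8 by rewrite mem_iota.
  move=> /allP/(_ _ (in_iota _ _ be e8))/allP/(_ _ (in_iota _ _ ef f8)).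
  move=> /Z.eqb_eq/(congr1 zr); rewrite !(zrM, zrD) zr_nat zr_sum.
  by under eq_bigr do rewrite !zrM.
have dd0 : d%:R * d%:R != 0 :> R by rewrite mulf_neq0.
have {ok} := ok i j k l (ltn_ord _) (ltn_ord _) (ltn_ord _) (ltn_ord _) => e.
transitivity ((\sum_(v <- L) z v i * z v j * (z v k * z v l)) / 16).
  by rewrite mulr_suml; apply: eq_bigr => v _; rewrite !mxE /z; field.
rewrite -[X in X / 16](mulKf dd0) e !mxE -!/(q _ _); field.
exact: d0.
Qed.

Lemma eval_sumE q (H : 'M[R]_q) (x : 'cV[R]_q) :
  eval H x = \sum_k \sum_l x k 0 * H k l * x l 0.
Proof.
rewrite /eval mxE exchange_big; apply: eq_bigr => l _; rewrite mxE mulr_suml.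
by apply: eq_bigr => k _; rewrite mxE.
Qed.

(** Contracting the fourth moment with H turns P_ij P_kl into <H, P> P and, H being symmetric, each
    of the other two products into P H P. *)
Lemma formop_design (H : 'M[R]_8) : H^T = H ->
  formop X H = zr c *: (ip H (projE d) *: projE d + 2 *: (projE d *m H *m projE d)).
Proof.
move=> SH; pose P := projE d; have SP i j : P i j = P j i 
  by have := congr1 (fun M : 'M_8 => M i j) (projE_sym d); rewrite mxE => ->.
apply/matrixP => i j; rewrite /formop big_design summxE.
transitivity (\sum_k \sum_l H k l * (zr c * (P i j * P k l +
    (P i k * P j l + P i l * P j k)))).
  under [RHS]eq_bigr => k _ do under eq_bigr => l _ do
    rewrite -moment4_design mulr_sumr.
  under [RHS]eq_bigr => k _ do rewrite exchange_big /=.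
  rewrite [RHS]exchange_big /=; apply: eq_bigr => v _.
  rewrite [LHS]mxE [Mx _ _ _]mxE big_ord_recl big_ord0 addr0 [_^T _ _]mxE.
  rewrite eval_sumE mulr_suml; apply: eq_bigr => k _; rewrite mulr_suml.
  by apply: eq_bigr => l _; ring.
rewrite ip_sum ?projE_sym // -/P [RHS]scalemxE addmxE !scalemxE.
have PHP : (P *m H *m P) i j = \sum_k \sum_l P i k * H k l * P j l.
  rewrite mxE exchange_big; apply: eq_bigr => l _; rewrite mxE mulr_suml.
  by apply: eq_bigr => k _; rewrite (SP l j).
have PHP' : \sum_k \sum_l P i l * H k l * P j k = (P *m H *m P) i j.
  rewrite PHP exchange_big; apply: eq_bigr => l _; apply: eq_bigr => k _.
  by rewrite -{1}SH [_^T _ _]mxE.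
rewrite mulr2n mulrDl !mul1r {1}PHP -PHP' mulr_suml -!big_split mulr_sumr /=.
apply: eq_bigr => k _; rewrite mulr_suml -!big_split mulr_sumr /=.
by apply: eq_bigr => l _; ring.
Qed.

End Design.
End TypeE.

(** * Components of arbitrary type *)

(** The known Coxeter numbers. Their agreement with |R|/k comes from the trace of the second moment,
    without counting roots. *)
Definition coxnum (t : rtype) : nat :=
  match t with
  | TypeA k => k.+1
  | TypeD k => 2 * k.-1
  | TypeE k => match k with 6 => 12 | 7 => 18 | _ => 30 end
  end.

(** Within one family the Coxeter number determines the rank; this is what makes n_a, n_d and n_e in
    (ii) common to all components of a type. *)
Lemma coxnum_inj s t : irreducible_type s -> irreducible_type t ->
  (is_A s = is_A t) -> (is_D s = is_D t) -> coxnum s = coxnum t -> s = t.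
Proof.
case: s t => [k|k|k] [l|l|l] //=.
- by move=> _ _ _ _ [->].
- case: k l => [|k] [|l] // _ _ _ _ /eqP; rewrite eqn_mul2l /= => /eqP ->.
  by [].
by rewrite !inE => /or3P[] /eqP -> /or3P[] /eqP ->.
Qed.

Section Components.
Variable R : realType.

Lemma std_roots_design k : irreducible_type (TypeE k) ->
  exists L d h c, [/\ (0 < d)%N, std_roots R (TypeE k) =i map (@half_vec R) L,
    design_ok L d h c, zr R h = (coxnum (TypeE k))%:R &
    2 * zr R c = 2 / 3 * (coxnum (TypeE k))%:R + 4].
Proof.
rewrite /= !inE => /or3P[] /eqP ->.
- exists listE6, 3%N; do 2!eexists.
  split; [by [] | exact: mem_rootsE6 | exact: design_E6 | reflexivity |].
  by rewrite -[zr R _]/(6 : R) /=; field.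
- exists listE7, 2%N; do 2!eexists.
  split; [by [] | exact: mem_rootsE7 | exact: design_E7 | reflexivity |].
  by rewrite -[zr R _]/(8 : R) /=; field.
exists listE8, 1%N; do 2!eexists.
split; [by [] | exact: mem_rootsE8 | exact: design_E8 | reflexivity |].
by rewrite -[zr R _]/(12 : R) /=; field.
Qed.

Lemma formop_frame N k (E : 'M[R]_(k, N)) (X : {fset 'cV[R]_N}) (H : 'M[R]_k) :
  E *m E^T = 1%:M -> <<[seq (row i E)^T | i : 'I_k]>>%VS = <<X>>%VS ->
  formop [fset E *m x | x in X]%fset H = conjmap E (formop X (E^T *m H *m E)).
Proof.
move=> EEt Esp; rewrite /formop (big_frame EEt Esp) linear_sum.
by apply: eq_bigr => x _; rewrite linearZ /= Mx_mul eval_mul.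
Qed.


Section TypeEComponent.
Variables (k : nat) (E : 'M[R]_(k, 8)).
Hypothesis k_irr : irreducible_type (TypeE k).
Hypothesis E_frame : frame (t := TypeE k) E.
Local Notation Y := (root_system (t := TypeE k) E).
Local Notation h := ((coxnum (TypeE k))%:R : R).
Let EEt : E *m E^T = 1%:M := E_frame.1.
Let E_span := E_frame.2.

Lemma coxnumE_neq0 : 2 * h != 0.
Proof. by rewrite mulf_neq0 ?pnatr_eq0 //=; case: k => [|[|[|[|[|[|[|[|]]]]]]]]. Qed.

Lemma sum_Mx_E : \sum_(y <- Y) Mx y = (2 * h) *: 1%:M.
Proof.
have [L [d [h' [c [d0 XL LD hh cc]]]]] := std_roots_design k_irr.
apply: (sum_Mx_frame EEt E_span (projE_sym R d) coxnumE_neq0).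
  exact: design_proj d0 XL LD.
by rewrite -hh; apply: (sum_Mx_design d0 XL LD).
Qed.

(** For the lift H' of H, <H', P> = tr H = 0 and P H' P = H', so L acts as 2c. *)
Lemma traceless_E_eigsp : (traceless R k <= eigsp Y (2 / 3 * h + 4))%VS.
Proof.
have [L [d [h' [c [d0 XL LD hh cc]]]]] := std_roots_design k_irr.
have EtE : E^T *m E = projE R d.
  apply: (frame_proj EEt E_span (projE_sym R d) coxnumE_neq0).
    exact: design_proj d0 XL LD.
  by rewrite -hh; apply: (sum_Mx_design d0 XL LD).
apply/subvP => H /tracelessP[SH tH]; apply/eigspP; split=> //.
rewrite (formop_frame _ EEt E_span) (formop_design d0 XL LD) ?lift_sym // -EtE.
have -> : ip (E^T *m H *m E) (E^T *m E) = 0.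
  by rewrite /ip mulmxA -[_ *m E *m E^T]mulmxA EEt mulmx1 mxtrace_lift.
rewrite scale0r add0r scalerA mulrC cc linearZ /= conjmapE; congr (_ *: _).
rewrite -[RHS](liftEK EEt) -[in RHS](liftEK EEt H) !mulmxA.
by rewrite !EEt !mul1mx -!mulmxA !EEt !mulmx1.
Qed.

End TypeEComponent.

Lemma std_roots_norm t x : irreducible_type t -> x \in std_roots R t -> dotv x x = 2.
Proof.
case: t x => k x k_irr /=; [exact: rootA_norm | exact: rootD_norm |].
have [L [d [h' [c [d0 XL LD _ _]]]]] := std_roots_design k_irr.
exact: (design_norm XL LD).
Qed.

Section OneComponent.
Variables (t : rtype) (E : 'M[R]_(rank t, ambient t)).
Hypothesis t_irr : irreducible_type t.
Hypothesis E_frame : frame E.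
Local Notation Y := (root_system E).
Local Notation h := ((coxnum t)%:R : R).

Lemma rank_gt0 : (0 < rank t)%N.
Proof. by case: t t_irr => k //=; [apply: leq_trans|rewrite !inE => /or3P[] /eqP ->]. Qed.

Lemma root_norm y : y \in Y -> dotv y y = 2.
Proof.
apply: (dotv_frame E_frame.1 E_frame.2) => x; exact: std_roots_norm.
Qed.

Lemma root_neq0 y : y \in Y -> y != 0.
Proof. by move/root_norm/dotv2_neq0. Qed.

Lemma sum_Mx_roots : \sum_(y <- Y) Mx y = (2 * h) *: 1%:M.
Proof.
case: t E t_irr E_frame => k E' k_irr fE.
- exact: sum_Mx_A.
- rewrite /= natrM; apply: sum_Mx_D => //.
  exact: leq_trans k_irr.
exact: sum_Mx_E.
Qed.

Lemma coxeter_root_system : coxeter Y = h.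
Proof. exact: coxeter_sum_Mx rank_gt0 root_norm sum_Mx_roots. Qed.

Lemma formop_scalar c : formop Y c%:M = (4 * h * c)%:M.
Proof.
rewrite /formop big_seq; under eq_bigr => y yY.
  rewrite eval_ip /ip mul_scalar_mx linearZ /= mxtrace_Mx root_norm //; over.
rewrite -big_seq -scaler_sumr sum_Mx_roots scalerA scalemx1; congr _%:M.
by ring.
Qed.

Lemma compU1A_eigsp : (compU1A E <= eigsp Y 4)%VS.
Proof.
case: t E t_irr E_frame => k E' k_irr fE; rewrite ?sub0v //.
exact: subv_trans (U1A_sub fE) (zero_diag_lift_eigsp fE).
Qed.

Lemma compU2A_eigsp : (compU2A E <= eigsp Y (2 * h))%VS.
Proof.
by case: t E t_irr E_frame => k E' k_irr fE; rewrite ?sub0v //; apply: U2A_eigsp.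
Qed.

Lemma compU1D_eigsp : (compU1D E <= eigsp Y 8)%VS.
Proof.
by case: t E t_irr E_frame => k E' k_irr fE; rewrite ?sub0v //; apply: U1D_eigsp.
Qed.

Lemma compU2D_eigsp : (compU2D E <= eigsp Y (2 * h - 4))%VS.
Proof.
case: t E t_irr E_frame => k E' k_irr fE; rewrite ?sub0v //= natrM.
by apply: U2D_eigsp => //; apply: leq_trans k_irr.
Qed.

Lemma compT0E_eigsp : (compT0E R t <= eigsp Y (2 / 3 * h + 4))%VS.
Proof.
case: t E t_irr E_frame => k E' k_irr fE; rewrite ?sub0v //.
exact: traceless_E_eigsp.
Qed.

Definition comp_spaces : seq {vspace 'M[R]_(rank t)} :=
  [:: compU1A E; compU2A E; compU1D E; compU2D E; compT0E R t].

Lemma comp_spaces_traceless i : (nth 0%VS comp_spaces i <= traceless R (rank t))%VS.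
Proof.
rewrite /comp_spaces; case: t E t_irr E_frame => k E' k_irr fE; case: i => [|[|[|[|[|i]]]]] /=;
  rewrite ?sub0v ?nth_nil ?sub0v //.
- exact: subv_trans (U1A_sub fE) (zero_diag_lift_traceless fE).
- exact: U2A_traceless.
- exact: U1D_traceless.
exact: U2D_traceless.
Qed.

Lemma traceless_comp : (traceless R (rank t) <= \sum_(V <- comp_spaces) V)%VS.
Proof.
rewrite /comp_spaces !big_cons big_nil addv0.
case: t E t_irr E_frame => k E' k_irr fE; rewrite /= ?addv0 ?add0v //.
  exact: traceless_subA.
exact: traceless_subD.
Qed.

Lemma comp_spaces_orth i j A B : (i < j)%N ->
  A \in nth 0%VS comp_spaces i -> B \in nth 0%VS comp_spaces j -> ip A B = 0.
Proof.
rewrite /comp_spaces; have ip0l (M : 'M[R]_(rank t)) : ip 0 M = 0 by rewrite ipC linear0.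
have ip0r (M : 'M[R]_(rank t)) : ip M 0 = 0 by rewrite linear0.
case: t E t_irr E_frame A B ip0l ip0r => k E' k_irr fE A B ip0l ip0r;
  case: i => [|[|[|[|[|i]]]]]; case: j => [|[|[|[|[|j]]]]] //= _;
  rewrite ?nth_nil ?memv0 => AU BU;
  try solve [by rewrite (eqP AU) | by rewrite (eqP BU)].
(* Only the pairs U_1, U_2 of type A and of type D remain; every other pair has a zero member. *)
- by apply: (zero_diag_lift_orth_U2A fE) BU; apply: (subvP (U1A_sub fE)).
exact: (U1D_orth_U2D fE) AU BU.
Qed.

End OneComponent.
End Components.

(** * Scalar blocks *)

Section DiagonalBlocks.
Variables (R : realType) (m : nat) (p : 'I_m -> nat).
Local Notation n := (\sum_i p i)%N.
Local Notation incl := (@incl R m p).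
Implicit Types U V : forall i, {vspace 'M[R]_(p i)}.

Lemma diag_sum_orth U V :
  (forall i A B, A \in U i -> B \in V i -> ip A B = 0) ->
  forall A B, A \in diag_sum U -> B \in diag_sum V -> ip A B = 0.
Proof.
move=> UV A B /diag_sumP[_ AU] /memv_sumP[Bs BV ->].
rewrite linear_sum big1 // => i _ /=; have /memv_imgP[C CV ->] := BV i isT.
by rewrite ip_conj_incl; apply: UV (AU i) CV.
Qed.

Lemma offdiag_orth U A B : A \in diag_sum U -> B \in offdiag R p -> ip A B = 0.
Proof.
move=> /memv_sumP[As AU ->] /offdiagP[_ B0].
rewrite ip_suml big1 // => i _ /=; have /memv_imgP[C CU ->] := AU i isT.
by rewrite ipC ip_conj_incl B0 /ip mul0mx linear0.
Qed.

Lemma diag_sumD U V : diag_sum (fun i => U i + V i)%VS = (diag_sum U + diag_sum V)%VS.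
Proof. by rewrite /diag_sum -big_split; apply: eq_bigr => i _; rewrite limgD. Qed.

Lemma diag_sumS U V : (forall i, U i <= V i)%VS -> (diag_sum U <= diag_sum V)%VS.
Proof.
move=> UV; apply/subvP => H /diag_sumP[H0 HU]; apply/diag_sumP; split=> // i.
exact: (subvP (UV i) _ (HU i)).
Qed.

Lemma mxtrace_blocks (H : 'M[R]_n) : \tr H = \sum_i \tr (submxblock H i i).
Proof. by rewrite -{1}[H]submxblockK mxtrace_mxblock. Qed.

Lemma diag_sum_traceless : (diag_sum (fun i => traceless R (p i)) <= traceless R n)%VS.
Proof.
apply/subv_sumP => i _; apply/subvP => _ /memv_imgP[A /tracelessP[SA tA] ->].
by apply/tracelessP; rewrite conj_sym // mxtrace_conj_incl.
Qed.

Lemma offdiag_traceless : (offdiag R p <= traceless R n)%VS.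
Proof.
apply/subvP => H /offdiagP[SH H0]; apply/tracelessP; split=> //.
by rewrite mxtrace_blocks big1 // => i _; rewrite H0 linear0.
Qed.

Lemma block_scalar_diag (c : 'rV[R]_m) i :
  submxblock (block_scalar p c) i i = (c 0 i)%:M.
Proof. exact: submxblock_diag. Qed.

Lemma block_scalar_off (c : 'rV[R]_m) i j : i != j ->
  submxblock (block_scalar p c) i j = 0.
Proof. by move=> ij; rewrite mxblockK (negPf ij). Qed.

(** Seen as a diagonal sum of lines, the scalar blocks can be tested for orthogonality and for the
    eigenvalue block by block. *)
Lemma Dspace_sub : (Dspace R p <= diag_sum (fun i => <[1%:M]>))%VS.
Proof.
apply/subvP => _ /memv_imgP[c _ ->]; rewrite lfunE /=; apply/diag_sumP; split.
  by move=> i j; apply: block_scalar_off.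
by move=> i; apply/vlineP; exists (c 0 i); rewrite block_scalar_diag scalemx1.
Qed.

Lemma block_scalar_traceless (c : 'rV[R]_m) :
  (block_scalar p c \in traceless R n) = (\sum_i c 0 i * (p i)%:R == 0).
Proof.
have tr : \tr (block_scalar p c) = \sum_i c 0 i * (p i)%:R.
  rewrite mxtrace_blocks; apply: eq_bigr => i _.
  by rewrite block_scalar_diag mxtrace_scalar mulr_natr.
apply/tracelessP/eqP => [[_ t0]|c0]; [by rewrite -tr | split; last by rewrite tr].
apply/mxblockP => i j; rewrite -tr_submxblock.
case: (eqVneq i j) => [<-|ij]; first by rewrite block_scalar_diag tr_scalar_mx.
by rewrite (block_scalar_off c ij) block_scalar_off 1?eq_sym // trmx0.
Qed.

(** The trace of [block_scalar p c], as a linear form in c. *)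
Definition weighted_sum (c : 'rV[R]_m) : R^o := \sum_i c 0 i * (p i)%:R.

Fact weighted_sum_is_linear : linear weighted_sum.
Proof.
move=> a c d; rewrite /weighted_sum scaler_sumr -big_split.
by apply: eq_bigr => i _ /=; rewrite !mxE mulrDl -mulrA.
Qed.
HB.instance Definition _ := GRing.isLinear.Build R 'rV[R]_m R^o _
  weighted_sum weighted_sum_is_linear.

(** As all blocks are nonempty, [block_scalar] is injective and the trace is a nonzero form on R^m,
    whose kernel has dimension m - 1. *)
Lemma dim_Dspace_traceless : (0 < m)%N -> (forall i, (0 < p i)%N) ->
  \dim (Dspace R p :&: traceless R n) = (m - 1)%N.
Proof.
move=> m0 p0.
have -> : (Dspace R p :&: traceless R n)%VS =
    (linfun (block_scalar p) @: lker (linfun weighted_sum))%VS.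
  apply/vspaceP => H; rewrite memv_cap; apply/andP/memv_imgP.
    case=> /memv_imgP[c _ ->]; rewrite lfunE /= block_scalar_traceless => wc.
    exists c; last by rewrite lfunE. 
    by rewrite memv_ker lfunE.
  case=> c; rewrite memv_ker lfunE => wc ->; rewrite memv_img ?memvf //.
  by rewrite lfunE /= block_scalar_traceless.
rewrite limg_dim_eq; last first.
  apply/eqP; rewrite -subv0; apply/subvP => c; rewrite memv_cap !memv_ker memv0 !lfunE.
  case/andP=> _ /eqP /= c0; apply/eqP/rowP => i; rewrite mxE.
  have := congr1 (fun M => submxblock M i i) c0.
  rewrite block_scalar_diag submxblock0 => /matrixP/(_ (Ordinal (p0 i)) (Ordinal (p0 i))).
  by rewrite !mxE eqxx.
have := limg_ker_dim (linfun weighted_sum) fullv; rewrite capfv dimvf /dim /= mul1n.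
suff -> : \dim (limg (linfun weighted_sum)) = 1%N by move=> e; rewrite -[in RHS]e addnK.
apply/eqP; rewrite eqn_leq; apply/andP; split.
  by apply: leq_trans (dimvS (subvf _)) _; rewrite dimvf.
rewrite lt0n dimv_eq0; apply/negP => /eqP w0.
pose i0 : 'I_m := Ordinal m0.
have : linfun weighted_sum (delta_mx 0 i0) \in limg (linfun weighted_sum) by rewrite memv_img ?memvf.
rewrite w0 memv0 lfunE /= /weighted_sum (@big_only1 _ _ _ _ i0) // => [|i ii0 _].
  by rewrite mxE !eqxx mul1r pnatr_eq0 eqn0Ngt p0.
by rewrite mxE (negPf ii0) andbF mul0r.
Qed.

(** From each diagonal block the scalar matrix of the same trace is split off. These scalars form an
    element of D whose trace is that of H, namely zero. *)
Lemma traceless_blocks : (forall i, (0 < p i)%N) ->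
  (traceless R n <= diag_sum (fun i => traceless R (p i)) +
     (Dspace R p :&: traceless R n) + offdiag R p)%VS.
Proof.
move=> p0; apply/subvP => H HT; have /tracelessP[SH tH] := HT.
pose c : 'rV[R]_m := \row_i (\tr (submxblock H i i) / (p i)%:R).
have cE i : c 0 i = \tr (submxblock H i i) / (p i)%:R by rewrite mxE.
have pn0 i : (p i)%:R != 0 :> R by rewrite pnatr_eq0 -lt0n.
have cD : block_scalar p c \in (Dspace R p :&: traceless R n)%VS.
  rewrite memv_cap block_scalar_traceless; apply/andP; split.
    by apply/memv_imgP; exists c; rewrite ?memvf // lfunE.
  by apply/eqP; rewrite -[RHS]tH mxtrace_blocks; apply: eq_bigr => i _; rewrite cE divfK.
pose T := \sum_i conjmap (incl i) (submxblock H i i - (c 0 i)%:M).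
have TT : T \in diag_sum (fun i => traceless R (p i)).
  apply: memv_sumr => i _; apply: memv_img; apply/tracelessP; split.
    by rewrite linearB /= block_sym // tr_scalar_mx.
  by rewrite linearB /= mxtrace_scalar cE -(mulr_natr (_ / _)) divfK ?subrr.
have Tii i : submxblock T i i = submxblock H i i - (c 0 i)%:M.
  rewrite submxblock_sum (@big_only1 _ _ _ _ i) ?submxblock_conjK // => j ji _.
  by rewrite submxblock_conj // eq_sym ji.
have Off : H - (T + block_scalar p c) \in offdiag R p.
  apply/offdiagP; split=> [|i].
    have /tracelessP[ST _] := subvP diag_sum_traceless T TT.
    have /tracelessP[Sc _] : block_scalar p c \in traceless R n.
      by move: cD; rewrite memv_cap => /andP[].
    by rewrite linearB linearD /= SH ST Sc.
  by rewrite submxblockB submxblockD Tii block_scalar_diag subrK subrr.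
by rewrite -[H](subrK (T + block_scalar p c)) addrC !memv_add.
Qed.

End DiagonalBlocks.

(** * Common ranks from a common Coxeter number, and the proof of (i) and (ii) *)

Section SameCoxeterNumber.
Variables (m : nat) (t : 'I_m -> rtype).
Hypothesis t_irr : forall i, irreducible_type (t i).
Hypothesis t_cox : forall i j, coxnum (t i) = coxnum (t j).

Lemma common_type (cls : rtype -> bool) (c : nat -> rtype) :
  (forall s, cls s -> s = c (rank s)) ->
  (forall s s', cls s -> cls s' -> is_A s = is_A s' /\ is_D s = is_D s') ->
  exists n, forall i, cls (t i) -> t i = c n.
Proof.
move=> cR cAD; case: (pickP (fun i => cls (t i))) => [j cj|none].
  exists (rank (t j)) => i ci; rewrite -cR //.
  by have [eA eD] := cAD _ _ ci cj; apply: coxnum_inj.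
(* A family without components leaves its rank arbitrary. *)
by exists 0%N => i; rewrite none.
Qed.

Lemma common_types : exists na nd ne,
  [/\ forall i, [\/ t i = TypeA na, t i = TypeD nd | t i = TypeE ne],
      m = (#|[set i | is_A (t i)]| + #|[set i | is_D (t i)]| +
           #|[set i | is_E (t i)]|)%N &
      (\sum_i rank (t i) = #|[set i | is_A (t i)]| * na +
        #|[set i | is_D (t i)]| * nd + #|[set i | is_E (t i)]| * ne)%N].
Proof.
have [||na Ha] := @common_type is_A TypeA; [by case | by case=> ? [] |].
have [||nd Hd] := @common_type is_D TypeD; [by case | by case=> ? [] |].
have [||ne He] := @common_type is_E TypeE; [by case | by case=> ? [] |].
have card_set (P : pred 'I_m) : #|[set i | P i]| = (\sum_i P i)%N.
  by rewrite cardsE -sum1_card big_mkcond; apply: eq_bigr => i _; rewrite unfold_in; case: (P i).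
exists na, nd, ne; split.
- move=> i; case e : (t i) => [k|k|k].
  + by apply: Or31; rewrite -e Ha ?e.
  + by apply: Or32; rewrite -e Hd ?e.
  + by apply: Or33; rewrite -e He ?e.
- rewrite !card_set -!big_split -[LHS]card_ord -sum1_card /=.
  by apply: eq_bigr => i _; case: (t i).
rewrite !card_set !big_distrl -!big_split /=; apply: eq_bigr => i _.
case e : (t i) => [k|k|k] /=; rewrite ?mul0n ?mul1n ?addn0 ?add0n.
- by have := Ha i; rewrite e => /(_ isT) [].
- by have := Hd i; rewrite e => /(_ isT) [].
by have := He i; rewrite e => /(_ isT) [].
Qed.

End SameCoxeterNumber.

Lemma Dspace_eigsp (R : realType) (m : nat) (t : 'I_m -> rtype)
    (E : forall i, 'M[R]_(rank (t i), ambient (t i))) (h : R) :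
  (forall i, irreducible_type (t i)) -> (forall i, frame (E i)) ->
  (forall i, (coxnum (t i))%:R = h) ->
  (Dspace R (fun i => rank (t i)) <=
     eigsp (orth_sum (fun i => root_system (E i))) (4 * h))%VS.
Proof.
move=> t_irr E_frame hE; have neq0 i x (xX : x \in root_system (E i)) : x != 0.
  exact: root_neq0 xX.
apply: subv_trans (Dspace_sub _ _) _; apply/subvP => H /diag_sumP[H0 H1].
apply/(eigsp_orth_sumP neq0); split=> [i|i j ij].
  have /vlineP[c ->] := H1 i; rewrite scalemx1; apply/eigspP.
  by rewrite tr_scalar_mx formop_scalar // hE scale_scalar_mx.
by rewrite (H0 i j ij) (H0 j i) 1?eq_sym // trmx0 scaler0.
Qed.

Theorem theorem4p7 (R : realType) (m : nat) (m_gt0 : (0 < m)%N)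
    (t : 'I_m -> rtype) (t_irr : forall i, irreducible_type (t i))
    (E : forall i, 'M[R]_(rank (t i), ambient (t i)))
    (E_frame : forall i, frame (E i)) :
  let n := (\sum_(i < m) rank (t i))%N in
  let Ri := fun i => root_system (E i) in
  let RR := orth_sum Ri in
  (* (i) *)
  [/\ forall H : 'M[R]_n, H \in symv R n ->
        Q RR H = \sum_(i < m) Q (Ri i) (submxblock H i i),
      forall G H : 'M[R]_n, G \in symv R n -> H \in symv R n ->
        (forall i, submxblock G i i = submxblock H i i) -> Q RR G = Q RR H &
      forall (b : seq 'M[R]_n) (bi : forall i, seq 'M[R]_(rank (t i))),
        orthonormal_basis b -> (forall i, orthonormal_basis (bi i)) ->
        forall a : R,
          multiplicity RR b a =
          (\sum_(i < m) multiplicity (Ri i) (bi i) a +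
           (if a == 0%R then
              \sum_(i < m) \sum_(j < m | i < j) rank (t i) * rank (t j)
            else 0))%N]
  /\
  (* (ii) *)
  forall h : R, (forall i, coxeter (Ri i) = h) ->
  let ma := #|[set i | is_A (t i)]| in
  let md := #|[set i | is_D (t i)]| in
  let me := #|[set i | is_E (t i)]| in
  let U1As := fun i => compU1A (E i) in
  let U2As := fun i => compU2A (E i) in
  let U1Ds := fun i => compU1D (E i) in
  let U2Ds := fun i => compU2D (E i) in
  let T0Es := fun i => compT0E R (t i) in
  let DT0 := (Dspace R (fun i => rank (t i)) :&: traceless R n)%VS in
  let Off := offdiag R (fun i => rank (t i)) in
  [/\ exists na nd ne : nat,
        [/\ forall i, [\/ t i = TypeA na, t i = TypeD nd | t i = TypeE ne],
            m = (ma + md + me)%N &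
            n = (ma * na + md * nd + me * ne)%N],
      orthogonal_decomposition (traceless R n)
        [:: diag_sum U1As; diag_sum U2As; diag_sum U1Ds; diag_sum U2Ds;
            diag_sum T0Es; DT0; Off],
      exists a1 a2 d1 d2 e : R,
        [/\ eigen_power Ri a1 U1As, eigen_power Ri a2 U2As,
            eigen_power Ri d1 U1Ds, eigen_power Ri d2 U2Ds &
            eigen_power Ri e T0Es],
      eigen_subspace RR (4 * h) DT0 /\ \dim DT0 = (m - 1)%N &
      eigen_subspace RR 0 Off].
Proof.
move=> n Ri RR; have neq0 i x : x \in Ri i -> x != 0 by apply: root_neq0.
split.
  split=> [H _|G H _ _ GH|b bi ob obi a]; first exact: Q_orth_sum.
    by rewrite !Q_orth_sum //; apply: eq_bigr => i _; rewrite GH.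
  rewrite multiplicity_dim // dim_eigsp_orth_sum //; congr (_ + _)%N.
  by apply: eq_bigr => i _; rewrite (multiplicity_dim _ _ (obi i)).
move=> h cox ma md me U1As U2As U1Ds U2Ds T0Es DT0 Off.
have hE i : (coxnum (t i))%:R = h by rewrite -(cox i) coxeter_root_system.
have rk0 i : (0 < rank (t i))%N by apply: rank_gt0.
have DT0_diag : (DT0 <= diag_sum (fun i => <[1%:M]>))%VS.
  exact: subv_trans (capvSl _ _) (Dspace_sub _ _).
pose S l i := nth 0%VS (comp_spaces (E i)) l.
have S_traceless l : (diag_sum (S l) <= traceless R n)%VS.
  apply: subv_trans (diag_sum_traceless _ _); apply: diag_sumS => i.
  exact: comp_spaces_traceless.
split.
- apply: common_types => // i j.
  by apply/eqP; rewrite -(eqr_nat R) !hE.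
- split.
    rewrite !big_cons big_nil addv0; apply/eqP; rewrite eqEsubv; apply/andP; split.
      apply: subv_trans (@traceless_blocks R m (fun i => rank (t i)) rk0) _.
      rewrite !addvA; do 2!apply: addvS => //.
      rewrite -!diag_sumD; apply: diag_sumS => i.
      have := traceless_comp (t_irr i) (E_frame i).
      by rewrite !big_cons big_nil addv0 !addvA.
    rewrite !subv_add (S_traceless 0%N) (S_traceless 1%N) (S_traceless 2%N).
    by rewrite (S_traceless 3%N) (S_traceless 4%N) capvSr offdiag_traceless.
  have SS l l' A B : (l < l')%N -> A \in diag_sum (S l) -> B \in diag_sum (S l') ->
      ip A B = 0.
    move=> ll'; apply: diag_sum_orth => i C D.
    exact: comp_spaces_orth.
  have SD l A B : A \in diag_sum (S l) -> B \in DT0 -> ip A B = 0.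
    (* Both matrices are diagonal sums, and a traceless block is orthogonal to every multiple of the
       identity. *)
    move=> AS /(subvP DT0_diag); move: AS; apply: diag_sum_orth => i C D CS.
    have /tracelessP[_ tC] := subvP (comp_spaces_traceless (t_irr i) (E_frame i) l) C CS.
    by case/vlineP=> c ->; rewrite ipZr /ip mulmx1 tC mulr0.
  have SO l A B : A \in diag_sum (S l) -> B \in Off -> ip A B = 0.
    exact: offdiag_orth.
  have DO A B : A \in DT0 -> B \in Off -> ip A B = 0.
    by move/(subvP DT0_diag); apply: offdiag_orth.
  move=> i j /andP[ij]; case: j ij => [|[|[|[|[|[|[|j]]]]]]] //=;
    case: i => [|[|[|[|[|[|i]]]]]] //= _ _ A B.
  + exact: (SS 0%N 1%N _ _ isT).
  + exact: (SS 0%N 2%N _ _ isT).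
  + exact: (SS 1%N 2%N _ _ isT).
  + exact: (SS 0%N 3%N _ _ isT).
  + exact: (SS 1%N 3%N _ _ isT).
  + exact: (SS 2%N 3%N _ _ isT).
  + exact: (SS 0%N 4%N _ _ isT).
  + exact: (SS 1%N 4%N _ _ isT).
  + exact: (SS 2%N 4%N _ _ isT).
  + exact: (SS 3%N 4%N _ _ isT).
  + exact: (SD 0%N).
  + exact: (SD 1%N).
  + exact: (SD 2%N).
  + exact: (SD 3%N).
  + exact: (SD 4%N).
  + exact: (SO 0%N).
  + exact: (SO 1%N).
  + exact: (SO 2%N).
  + exact: (SO 3%N).
  + exact: (SO 4%N).
(* Each value depends only on the family and on h, so the common Coxeter number gives all components
   of a family the same eigenvalue. *)
- exists 4, (2 * h), 8, (2 * h - 4), (2 / 3 * h + 4).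
  split; apply: eigen_powerP => // i; rewrite -?(hE i).
  + exact: compU1A_eigsp.
  + exact: compU2A_eigsp.
  + exact: compU1D_eigsp.
  + exact: compU2D_eigsp.
  + exact: compT0E_eigsp.
- split; last exact: dim_Dspace_traceless.
  apply/eigen_subspaceP; apply: subv_trans (capvSl _ _) _.
  exact: Dspace_eigsp.
apply/eigen_subspaceP; rewrite eigsp_orth_sum // eqxx; exact: addvSr.
Qed.
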